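(* A connected graph $H$ has all but at most three adjacency eigenvalues (counted with multiplicity) equal to $-1$ or $0$ if and only if $H$ is a mixed extension of a connected graph with no more than three vertices, or $H$ is (isomorphic to) one of the following mixed extensions of the path $P_4$ or $P_5$, where $p,q,r,s$ are integers: (a) a mixed extension of $P_4$ of type $(p,-3,-2,-2)$, $(-2,q,r,-2)$, or $(p,-2,r,-3)$, with $p,q,r\geq 1$; (b) a mixed extension of $P_4$ of type $(p,q,-r,s)$, with $r\geq 1$ and $(p,q,s)\in\{(3,3,6),(3,4,4),(3,6,3),(4,2,6),(4,3,3),(4,6,2),(5,2,4),(5,4,2),(7,2,3),(7,3,2)\}$; (c) a mixed extension of $P_4$ of type $(p,q,r,s)$, with $(p,q,r,s)\in\{(2,2,2,7),(2,2,3,4),(2,2,6,3),(2,3,2,5),(2,3,4,3),(2,5,2,4),(2,5,3,3),(3,2,2,3)\}$; (d) a mixed extension of $P_5$ of type $(1,p,-q,r,1)$ with $p,q,r\geq 1$.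
   Context: All graphs are finite, simple and undirected, with at least one vertex; eigenvalues of a graph are those of its adjacency matrix, counted with multiplicity. Mixed extension: let $G$ be a graph with vertex set $\{1,\ldots,n\}$ and let $(t_1,\ldots,t_n)$ be an $n$-tuple of nonzero integers. The mixed extension of $G$ of type $(t_1,\ldots,t_n)$ is the graph whose vertex set is the union of mutually disjoint sets $V_1,\ldots,V_n$ with $|V_i|=|t_i|$, where the vertices of $V_i$ are mutually adjacent (a clique) if $t_i>0$ and mutually nonadjacent (a coclique) if $t_i<0$, and where, for $i\neq j$, every vertex of $V_i$ is adjacent to every vertex of $V_j$ if $i$ and $j$ are adjacent in $G$, and no vertex of $V_i$ is adjacent to a vertex of $V_j$ otherwise. (The values $t_i=1$ and $t_i=-1$ both mean that $V_i$ is a single vertex.) A graph is a mixed extension of $G$ if it is isomorphic to the mixed extension of $G$ of some type. The path $P_n$ has vertices $1,\ldots,n$ in their order along the path, so $i$ and $j$ are adjacent iff $|i-j|=1$. *)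

(* Defs.v *)
From mathcomp Require Import all_boot all_order all_algebra all_field.

Set Implicit Arguments.
Unset Strict Implicit.
Unset Printing Implicit Defensive.

Import GRing.Theory.
Local Open Scope ring_scope.

Record sgraph := SGraph {
  vertex :> finType;
  adj : rel vertex;
  adj_sym : symmetric adj;
  adj_irr : irreflexive adj
}.

Definition graph_connected (G : sgraph) : Prop :=
  forall x y : G, connect (@adj G) x y.

Definition graph_iso (G H : sgraph) : Prop :=
  exists2 f : G -> H, bijective f & forall x y, adj (f x) (f y) = adj x y.

Definition adjacency_mx (G : sgraph) : 'M[algC]_#|G| :=
  \matrix_(i, j) (adj (enum_val i) (enum_val j))%:R.

(* The characteristic polynomial is monic, so it is the product of the
   'X - z%:P over this sequence: each eigenvalue is repeated according to its
   multiplicity. *)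
Definition eigenvalues (G : sgraph) : seq algC :=
  sval (closed_field_poly_normal (char_poly (adjacency_mx G))).

Section MixedExtension.
Variables (G : sgraph) (t : G -> int).

(* Disjoint union of the V_i, with V_i = 'I_`|t i|. *)
Definition mixed_vertex : finType := {i : G & 'I_(`|t i|%N)}.

Definition mixed_adj : rel mixed_vertex := fun u v =>
  if tag u == tag v then (0 < t (tag u)) && (u != v)
  else adj (tag u) (tag v).

Lemma mixed_adj_sym : symmetric mixed_adj.
Proof.
move=> u v; rewrite /mixed_adj eq_sym [v == u]eq_sym adj_sym.
by case: eqP => // ->.
Qed.

Lemma mixed_adj_irr : irreflexive mixed_adj.
Proof. by move=> u; rewrite /mixed_adj !eqxx andbF. Qed.

Definition mixed_extension : sgraph := SGraph mixed_adj_sym mixed_adj_irr.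

End MixedExtension.

Definition is_mixed_extension_of_type (H G : sgraph) (t : G -> int) : Prop :=
  (forall i, t i != 0) /\ graph_iso H (mixed_extension t).

Definition is_mixed_extension (H G : sgraph) : Prop :=
  exists t : G -> int, is_mixed_extension_of_type H t.

Section Path.
Variable n : nat.

(* Vertices are numbered from 0 instead of 1. *)
Definition path_adj : rel 'I_n := fun i j => (i.+1 == j) || (j.+1 == i).

Lemma path_adj_sym : symmetric path_adj.
Proof. by move=> i j; rewrite /path_adj orbC. Qed.

Lemma path_adj_irr : irreflexive path_adj.
Proof. by move=> i; rewrite /path_adj orbb gtn_eqF. Qed.

Definition path_graph : sgraph := SGraph path_adj_sym path_adj_irr.

End Path.

Definition is_path_mixed_extension (H : sgraph) (n : nat) (t : n.-tuple int) :
    Prop :=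
  @is_mixed_extension_of_type H (path_graph n) (tnth t).

(* Main.v *)
(* An eigenvalue differs from -1 and 0 iff it is not a root of x^2 + x, so the
   number of such eigenvalues is the rank of A^2 + A, whose entries count walks
   of length one and two. This rank is at least 4 as soon as an induced subgraph
   carries four orthogonal vectors on which the form A^2 + A is positive, since
   A^2 + A dominates its restriction to an induced subgraph.

   A connected graph is built up by adding vertices one at a time, each adjacent
   to an earlier one. A vertex added to a mixed extension splits every class
   into neighbours and nonneighbours, and only the sizes of the parts capped at
   two matter for finding twenty-two small graphs as above. A finite search
   shows that either one of them appears, or the result is again a mixed
   extension of a connected graph on at most three vertices, of P4, or of P5
   of type (1, p, -q, r, 1).

   For P4 the rank is at most 3 iff the 4 x 4 quotient matrix has eigenvalue 0
   or -1. Dividing column i by |t_i| makes it tridiagonal with ones next to the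
   diagonal, and its singularity becomes an equation between unit fractions
   with finitely many solutions for the class sizes involved. *)
Require Import Defs.
From mathcomp Require Import all_boot all_order all_algebra all_field.
From mathcomp Require Import ring lra zify.

Import GRing.Theory Num.Theory Order.TTheory.
Local Open Scope ring_scope.

Set Implicit Arguments.
Unset Strict Implicit.
Unset Printing Implicit Defensive.

(** * The rank of A^2 + A *)

Lemma char_poly_similar (F : fieldType) n (P A B : 'M[F]_n) :
  P \in unitmx -> P *m A = B *m P -> char_poly A = char_poly B.
Proof.
move=> Pu PA; rewrite /char_poly /char_poly_mx; set Q := map_mx polyC P.
have QX : Q *m ('X%:M - map_mx polyC A) = ('X%:M - map_mx polyC B) *m Q.
  by rewrite mulmxBr mulmxBl -!map_mxM PA scalar_mxC.
have Q0 : \det Q != 0 by rewrite det_map_mx polyC_eq0 -unitfE -unitmxE.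
by have := congr1 determinant QX; rewrite !det_mulmx mulrC => /(mulIf Q0).
Qed.



Lemma rank_diag_mx (F : fieldType) n (d : 'rV[F]_n) :
  \rank (diag_mx d) = (\sum_i (d ord0 i != 0%R))%N.
Proof.
elim: n d => [|n IH]; first by move=> d; rewrite thinmx0 mxrank0 big_ord0.
rewrite -[n.+1]/(1 + n)%N => d; rewrite -[d]hsubmxK diag_mx_row rank_diag_block_mx IH.
rewrite big_split_ord big_ord1 /=; congr (_ + _)%N; last first.
  by apply: eq_bigr => i _; rewrite row_mxEr.
rewrite row_mxEl rank_rV; congr (nat_of_bool (~~ _)).
apply/eqP/eqP => [/matrixP /(_ 0 0)|d0]; first by rewrite !mxE eqxx mulr1n.
by apply/matrixP=> i j; rewrite !ord1 !mxE eqxx mulr1n -d0 !mxE.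
Qed.

(** [A] is real symmetric, so the spectral theorem diagonalises it, and the rank counts the diagonal
    entries [x] with [x * (x + 1)] nonzero. *)
Lemma count_eigenvalues (H : sgraph) (A := adjacency_mx H) :
  count (fun x : algC => x \notin [:: -1; 0]) (eigenvalues H) =
  \rank (A *m A + A)%R.
Proof.
have An : A \is normalmx.
  apply: symmetric_normalmx.
    apply/is_hermitianmxP; rewrite expr0 scale1r map_mx_id //.
    by apply/matrixP=> i j; rewrite !mxE adj_sym.
  by apply/mxOverP=> i j; rewrite mxE realn.
have /orthomx_spectralP := An.
set P := spectralmx A; set d := spectral_diag A => dA.
have Pu : P \in unitmx by apply: spectral_unit.
have PA : P *m A = diag_mx d *m P by rewrite dA !mulmxA mulmxV // mul1mx.
have cA : char_poly A = \prod_(x <- [seq d 0 i | i <- enum 'I_#|H|]) ('X - x%:P).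
  rewrite (char_poly_similar Pu PA) char_poly_trig ?diag_mx_is_trig //.
  by rewrite big_map big_enum; apply: eq_bigr => i _; rewrite mxE eqxx.
have eA : perm_eq (eigenvalues H) [seq d 0 i | i <- enum 'I_#|H|].
  rewrite /eigenvalues; case: closed_field_poly_normal => s /= sE.
  apply: prod_XsubC_eq. 
  have := char_poly_monic A; rewrite qualifE => /eqP lA.
  by rewrite -cA -/A sE lA scale1r.
rewrite (permP eA) count_map.
have -> : A *m A + A = invmx P *m (diag_mx (\row_i (d 0 i * d 0 i + d 0 i))) *m P.
  have -> : diag_mx (\row_i (d 0 i * d 0 i + d 0 i)) =
      diag_mx d *m diag_mx d + diag_mx d.
    apply/matrixP=> i j; rewrite mul_diag_mx !mxE.
    by case: eqP => [->|_]; rewrite ?mulr1n ?mulr0n ?mulr0 ?addr0.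
  rewrite mulmxDr mulmxDl -dA; congr (_ + _).
  by rewrite {1 2}dA !mulmxA mulmxK.
rewrite mxrankMfree ?row_free_unit // (eqmxMfull _ _) ?row_full_unit ?unitmx_inv //.
rewrite rank_diag_mx -sum1_count big_mkcond big_enum /=.
apply: eq_bigr => i _; rewrite mxE.
have -> : d 0 i * d 0 i + d 0 i = d 0 i * (d 0 i + 1) by rewrite mulrDr mulr1.
by rewrite mulf_eq0 addr_eq0 !inE !negb_or /= andbC; do 2 case: eqP.
Qed.

Definition nbr_sum (H : sgraph) (y : H -> rat) (u : H) : rat :=
  \sum_v (adj u v)%:R * y v.

Definition shift_sum (H : sgraph) (y : H -> rat) (u : H) : rat :=
  nbr_sum (fun v => nbr_sum y v + y v) u.

Definition walk (H : sgraph) (u z : H) : rat :=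
  \sum_v (adj u v)%:R * (adj v z)%:R + (adj u z)%:R.

(** Over the rationals quadratic forms can be positive; the rank does not change under field
    extension. *)
Definition ratA (H : sgraph) : 'M[rat]_#|H| :=
  \matrix_(i, j) (adj (enum_val i) (enum_val j))%:R.

Lemma sum_enum_val (H : sgraph) (f : H -> rat) :
  \sum_(i < #|H|) f (enum_val i) = \sum_v f v.
Proof. by rewrite -(big_enum_val f). Qed.

Local Notation walk_rank H := (\rank (ratA H *m ratA H + ratA H)%R).

Lemma walk_mx (H : sgraph) i j :
  (ratA H *m ratA H + ratA H)%R i j = walk (enum_val i) (enum_val j).
Proof.
rewrite !mxE /walk -sum_enum_val; congr (_ + _).
by apply: eq_bigr => k _; rewrite !mxE.
Qed.

Lemma rank_ratA (H : sgraph) :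
  \rank (adjacency_mx H *m adjacency_mx H + adjacency_mx H)%R
  = walk_rank H.
Proof.
rewrite -(mxrank_map (ratr : {rmorphism rat -> algC})) map_mxD map_mxM.
have -> //: map_mx ratr (ratA H) = adjacency_mx H.
by apply/matrixP=> i j; rewrite !mxE ratr_nat.
Qed.

Definition vec (H : sgraph) (y : H -> rat) : 'rV[rat]_#|H| := \row_i y (enum_val i).

Lemma vec_mul (H : sgraph) (y : H -> rat) : vec y *m ratA H = vec (nbr_sum y).
Proof.
apply/rowP=> j; rewrite !mxE /nbr_sum -sum_enum_val; apply: eq_bigr => i _.
by rewrite !mxE adj_sym mulrC.
Qed.

(** The images of the [w i] under [A^2 + A] lie in a space of dimension less than [k], hence are
    dependent. Here [shift_sum y] is [A (A + 1) y]. *)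
Lemma rank_ltP (H : sgraph) k (w : 'I_k -> H -> rat) :
  (walk_rank H < k)%N ->
  exists2 x : 'I_k -> rat, (exists i, x i != 0) &
    forall u, shift_sum (fun v => \sum_i x i * w i v) u = 0.
Proof.
set M := (_ + _) => rM.
pose W := \matrix_(i < k) vec (w i).
have rWM : ~~ row_free (W *m M).
  by rewrite /row_free neq_ltn (leq_ltn_trans (mxrankM_maxr _ _) rM).
pose x := nz_row (kermx (W *m M)).
have x0 : x != 0 by rewrite nz_row_eq0 kermx_eq0.
exists (fun i => x 0 i).
  apply/existsP; apply: contraR x0 => /existsPn x0.
  by apply/eqP/rowP=> i; rewrite mxE; apply/eqP/negPn.
set y := fun v => _ => u.
have yE : x *m W = vec y.
  by apply/rowP=> j; rewrite !mxE; apply: eq_bigr => i _; rewrite !mxE.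
have : x *m (W *m M) = 0 by apply/sub_kermxP/nz_row_sub.
rewrite mulmxA yE mulmxDr mulmxA -mulmxDl !vec_mul.
have -> : vec (nbr_sum y) + vec y = vec (fun v => nbr_sum y v + y v).
  by apply/rowP=> j; rewrite !mxE.
by rewrite vec_mul => /rowP /(_ (enum_rank u)); rewrite !mxE enum_rankK.
Qed.

Lemma rank_le_span (H : sgraph) k (r : 'I_k -> H) (a : H -> 'I_k -> rat) :
  (forall u z, walk u z = \sum_i a u i * walk (r i) z) ->
  (walk_rank H <= k)%N.
Proof.
move=> walkE; set M := (_ + _).
pose B := \matrix_(i < k) row (enum_rank (r i)) M.
suff -> : M = (\matrix_(u, i) a (enum_val u) i) *m B.
  by rewrite (leq_trans (mxrankM_maxl _ _)) // rank_leq_col.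
apply/matrixP=> u z; rewrite walk_mx walkE mxE; apply: eq_bigr => i _.
by rewrite [B _ _]mxE [row _ _ _ _]mxE walk_mx enum_rankK mxE.
Qed.

Lemma nbr_sum_adj (H : sgraph) (y z : H -> rat) :
  \sum_u y u * nbr_sum z u = \sum_u nbr_sum y u * z u.
Proof.
under eq_bigr do rewrite /nbr_sum big_distrr /=.
rewrite exchange_big; apply: eq_bigr => v _; rewrite /nbr_sum big_distrl /=.
by apply: eq_bigr => u _; rewrite adj_sym mulrA [y u * _]mulrC.
Qed.

(* [A^2 + A] dominates its restriction to an induced subgraph: the extra term
   is [N *m N^T], with [N] the adjacency between the subgraph and the rest. *)
Lemma positive_subspace (H : sgraph) m k (f : 'I_m -> H) (W : 'I_k -> 'I_m -> rat)
    (nbW := fun i b => \sum_a (adj (f b) (f a))%:R * W i a)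
    (q := fun i j => \sum_b (nbW i b + W i b) * nbW j b) :
  injective f -> (forall i, 0 < q i i) -> (forall i j, i != j -> q i j = 0) ->
  (k <= walk_rank H)%N.
Proof.
move=> f_inj q_gt0 q0; rewrite leqNgt; apply/negP => rk.
pose w i v : rat := \sum_a (f a == v)%:R * W i a.
have [x [i0 xi0] ker] := rank_ltP w rk.
pose om a := \sum_i x i * W i a.
pose y v : rat := \sum_a (f a == v)%:R * om a.
have yE v : \sum_i x i * w i v = y v.
  rewrite /y /w; under eq_bigr do rewrite big_distrr /=.
  rewrite exchange_big; apply: eq_bigr => a _; rewrite /om big_distrr /=.
  by apply: eq_bigr => i _; rewrite mulrCA.
have ysum (g : H -> rat) : \sum_v g v * y v = \sum_a g (f a) * om a.
  rewrite /y; under eq_bigr do rewrite big_distrr /=.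
  rewrite exchange_big; apply: eq_bigr => a _.
  rewrite (bigD1 (f a)) //= eqxx mul1r big1 ?addr0 // => v /negPf vf.
  by rewrite eq_sym vf mul0r mulr0.
pose be b := \sum_i x i * nbW i b.
have nyE b : nbr_sum y (f b) = be b.
  rewrite /nbr_sum ysum /be /nbW; under [RHS]eq_bigr do rewrite big_distrr /=.
  rewrite exchange_big; apply: eq_bigr => a _; rewrite /om big_distrr /=.
  by apply: eq_bigr => i _; rewrite mulrCA.
(* [y] is in the kernel of [A^2 + A], so the form of [H] vanishes at [y]. *)
have sum0 : \sum_v (nbr_sum y v + y v) * nbr_sum y v = 0.
  rewrite nbr_sum_adj.
  under eq_bigr => u _.
    have -> : nbr_sum (fun v => nbr_sum y v + y v) u = 0.
      rewrite -(ker u) /shift_sum /nbr_sum.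
      by apply: eq_bigr => v _; congr (_ * (_ + _)); [apply: eq_bigr => v' _|]; rewrite yE.
    by rewrite mul0r; over.
  by rewrite big1.
(* Orthogonality kills the mixed terms, so the form of the subgraph is positive at [om]. *)
have : 0 < \sum_b (be b + om b) * be b.
  have -> : \sum_b (be b + om b) * be b = \sum_i x i ^+ 2 * q i i.
    transitivity (\sum_i \sum_j x i * x j * q i j).
      rewrite /q; under [RHS]eq_bigr do under eq_bigr do rewrite big_distrr /=.
      under [RHS]eq_bigr do rewrite exchange_big /=.
      rewrite [RHS]exchange_big /=; apply: eq_bigr => b _.
      rewrite -big_split /= big_distrl /=; apply: eq_bigr => i _.
      rewrite big_distrr /=; apply: eq_bigr => j _; ring.
    apply: eq_bigr => i _; rewrite (bigD1 i) //= big1 ?addr0 ?expr2 // => j ji.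
    by rewrite q0 ?mulr0 // eq_sym.
  rewrite (bigD1 i0) //=; apply: ltr_pwDl.
    by rewrite mulr_gt0 // exprn_even_gt0.
  by apply: sumr_ge0 => i _; rewrite mulr_ge0 ?sqr_ge0 // ltW.
(* Each form is a sum of squares of neighbour sums plus a term supported on the image of [f]. The
   latter terms agree, and [H] has at least the squares of the subgraph. *)
apply/negP; rewrite -real_leNgt ?num_real // -[leRHS]sum0.
rewrite [leRHS](eq_bigr (fun v => nbr_sum y v ^+ 2 + nbr_sum y v * y v)); last first.
  by move=> v _; ring.
rewrite big_split /= ysum.
rewrite (eq_bigr (fun b => be b ^+ 2 + nbr_sum y (f b) * om b)); last first.
  by move=> b _; rewrite nyE; ring.
rewrite big_split /= lerD2r.
rewrite (eq_bigr (fun b => nbr_sum y (f b) ^+ 2)); last by move=> b _; rewrite nyE.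
rewrite -(big_map f xpredT (fun v => nbr_sum y v ^+ 2)) -[index_enum _]enumT.
rewrite big_uniq ?map_inj_uniq -?enumT ?enum_uniq //=.
rewrite [leRHS](bigID (mem (map f (enum 'I_m)))) lerDl sumr_ge0 // => v _.
exact: sqr_ge0.
Qed.

(** * Forbidden subgraphs and the search *)

Local Open Scope nat_scope.

(* [&&], [||], [has] and [all] evaluate both arguments under call by value;
   the computations below branch with [if] instead. *)
Fixpoint lazy_has (T : Type) (p : T -> bool) (s : seq T) :=
  if s is x :: s' then if p x then true else lazy_has p s' else false.

Fixpoint lazy_all (T : Type) (p : T -> bool) (s : seq T) :=
  if s is x :: s' then if p x then lazy_all p s' else false else true.

Lemma lazy_hasE (T : Type) (p : T -> bool) s : lazy_has p s = has p s.
Proof. by elim: s => //= x s ->. Qed.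

Lemma lazy_allE (T : Type) (p : T -> bool) s : lazy_all p s = all p s.
Proof. by elim: s => //= x s ->. Qed.

(** Backtracking over words on [dom]: [step] prunes, while [goal] tests each complete word, and
    correctness rests on [goal]. *)
Fixpoint search (goal : seq nat -> bool) (step : seq nat -> nat -> bool)
    (dom : seq nat) (k : nat) (s : seq nat) : bool :=
  if k is k'.+1
  then lazy_has (fun a => if step s a then search goal step dom k' (rcons s a)
                          else false) dom
  else goal s.

Lemma search_goal goal step dom k s :
  search goal step dom k s -> exists s', goal s'.
Proof.
elim: k s => [|k IH] s /=; first by exists s.
by rewrite lazy_hasE => /hasP [a _]; case: ifP => // _ /IH.
Qed.

(* A graph on [0, size r) is coded by the rows [r_i] listing the neighbours
   [j <= i] of [i]; in a template, [i \in r_i] means that class [i] is a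
   clique. *)
Definition row_adj (r : seq (seq nat)) : rel nat :=
  fun i j => (j \in nth [::] r i) || (i \in nth [::] r j).

Definition tabulate (n : nat) (e : rel nat) : seq (seq bool) :=
  mkseq (fun i => mkseq (e i) n) n.

Definition table_adj (M : seq (seq bool)) : rel nat :=
  fun i j => nth false (nth [::] M i) j.

Lemma tabulateE n e i j : i < n -> j < n -> table_adj (tabulate n e) i j = e i j.
Proof. by move=> ni nj; rewrite /table_adj !nth_mkseq. Qed.

Fixpoint agree (row : seq bool) (e : seq nat) (bs : seq bool) : bool :=
  match e, bs with
  | x :: e', b :: bs' =>
      if eqb (nth false row x) b then agree row e' bs' else false
  | _, _ => true
  end.

(* [m] gives the number of vertices available in each cell. *)
Section Search.
Variables (M : seq (seq bool)) (m : seq nat).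

Definition is_embedding (F : seq (seq nat)) (e : seq nat) : bool :=
  [&& size e == size F,
      all (fun j => count_mem j e <= nth 0 m j) e &
      all (fun a => all (fun b => (a == b) ||
             (table_adj M (nth 0 e a) (nth 0 e b) == row_adj F a b))
           (iota 0 (size F))) (iota 0 (size F))].

Definition embed_step (tF : seq (seq bool)) (e : seq nat) (j : nat) : bool :=
  if count_mem j e < nth 0 m j
  then agree (nth [::] M j) e (nth [::] tF (size e)) else false.

Definition nonempty_cells : seq nat := [seq j <- iota 0 (size m) | 0 < nth 0 m j].

(* Only embeddings sending vertex 0 of [F] to cell 0, which holds the newly
   added vertex, are searched. *)
Definition embeds (cells : seq nat) (F : seq (seq nat) * seq (seq bool)) : bool :=
  search (is_embedding F.1) (embed_step F.2) cells (size F.1).-1 [:: 0].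

(** [g] assigns classes of [T] to the nonempty cells; the five conditions yield those of
    [classified], in the same order. A cell with count one contains no pair, so its diagonal entry
    is ignored. *)
Definition is_merging (T : seq (seq nat) * seq nat) (g : seq nat) : bool :=
  let cs := nonempty_cells in
  let f j := nth 0 g (index j cs) in
  [&& all (fun j => f j < size T.1) cs,
      all (fun a => has (fun j => f j == a) cs) (iota 0 (size T.1)),
      all (fun j => all (fun k => ((j == k) && (nth 0 m j <= 1)) ||
             (table_adj M j k == row_adj T.1 (f j) (f k))) cs) cs,
      all (fun a => row_adj T.1 a a ||
             has (fun j => has (fun k => [&& f j == a, f k == a &
                    (j != k) || (1 < nth 0 m j)]) cs) cs) (iota 0 (size T.1)) &
      all (fun a => all (fun j => all (fun k =>
             (f j == a) && (f k == a) ==> (j == k) && (nth 0 m j <= 1)) cs) cs)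
          T.2].

Definition merge_step (cs : seq nat) (tT : seq (seq bool)) (g : seq nat) a :=
  let j := nth 0 cs (size g) in
  let row := nth [::] M j in
  let rowT := nth [::] tT a in
  if if nth 0 m j <= 1 then true else eqb (nth false row j) (nth false rowT a)
  then agree row cs [seq nth false rowT i | i <- g] else false.

Definition merges (T : seq (seq nat) * seq nat * seq (seq bool)) : bool :=
  let cs := nonempty_cells in
  search (is_merging T.1) (merge_step cs T.2) (iota 0 (size T.1.1)) (size cs) [::].

End Search.

(* Adding a vertex [v] to a graph with the classes of the template [T]: cell 0
   is [v], and class [i] splits into the cells [2i+1] (nonneighbours of [v])
   and [2i+2] (neighbours of [v]). *)
Definition split_adj (T : seq (seq nat)) : rel nat := fun j k =>
  if j == 0 then (k != 0) && ~~ odd k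
  else if k == 0 then ~~ odd j
  else row_adj T j.-1./2 k.-1./2.

Definition signed (T : seq (seq nat)) (s : seq bool) : seq (seq nat) :=
  mkseq (fun i => let r := nth [::] T i in if nth true s i then i :: r else r)
    (size T).

Fixpoint words n : seq (seq bool) :=
  if n is n'.+1
  then [seq b :: s | b <- [:: true; false], s <- words n'] else [:: [::]].

Definition binary (s : seq bool) := foldl (fun x (b : bool) => x.*2 + b) 0 s.

Definition path_rows n : seq (seq nat) :=
  mkseq (fun i => if i is i'.+1 then [:: i'] else [::]) n.

Definition triangle_rows : seq (seq nat) := [:: [::]; [:: 0]; [:: 0; 1]].

(* A template is a graph with signed vertices and the list of the classes that
   are required to be singletons; classes that are not cliques are required to
   have at least two vertices. Signed graphs that reduce to a smaller template,
   and mirror images of signed paths, are left out. *)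
Definition templates : seq (seq (seq nat) * seq nat) :=
  [:: (signed (path_rows 1) [:: true], [::]);
      (signed (path_rows 2) [:: false; true], [::]);
      (signed (path_rows 2) [:: false; false], [::]);
      (signed triangle_rows [:: false; false; true], [::]);
      (signed triangle_rows [:: false; false; false], [::])]
  ++ [seq (signed (path_rows n) s, [::])
        | n <- [:: 3; 4], s <- [seq s <- words n | binary s <= binary (rev s)]]
  ++ [:: (signed (path_rows 5) [:: true; true; false; true; true], [:: 0; 4]);
         (signed (path_rows 5) [:: true; true; true; true; true], [:: 0; 2; 4])].

(* The graphs [F] with four eigenvalues outside [-1, 0] that are met below,
   with the vertices playing the role of [v], and four vectors that are
   orthogonal for the quadratic form of [A^2 + A] and on which it is
   positive. *)
Definition forbidden_data : seq (seq nat * seq (seq nat) * seq (seq int)) := [::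
  ([:: 0; 2; 3; 4], [:: [::]; [::]; [::]; [:: 0; 1]; [:: 0; 1; 2; 3]],
   ([:: [:: 0; 0; 1; 0; 0]; [:: 0; 0; 0; 1; -1];
        [:: 0; 0; 1; -1; 0]; [:: 1; 1; -1; -1; 0]])%R);
  ([:: 0; 2; 3], [:: [::]; [::]; [::]; [:: 1; 2]; [:: 0; 2; 3]],
   ([:: [:: 0; 0; 1; 0; 0]; [:: 0; 0; 0; 1; -1];
        [:: 1; -1; 0; 0; 0]; [:: 1; 1; 1; -1; -1]])%R);
  ([:: 0; 2; 3], [:: [::]; [:: 0]; [::]; [:: 1; 2]; [:: 0; 2; 3]],
   ([:: [:: 0; 0; 1; 0; 0]; [:: 0; 0; 1; -1; 0];
        [:: 0; 0; 1; 0; -1]; [:: 1; 1; 1; -1; -1]])%R);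
  ([:: 0; 2], [:: [::]; [::]; [::]; [:: 2]; [:: 1; 3]; [:: 0; 2; 4]],
   ([:: [:: 0; 0; 0; 0; 0; 1]; [:: 0; 0; 1; 0; -1; 0];
        [:: 0; 1; 0; 0; -1; 0]; [:: 0; 1; 1; 1; -1; -1]])%R);
  ([:: 0], [:: [::]; [::]; [:: 1]; [:: 0; 2]; [:: 0; 1]],
   ([:: [:: 0; 0; 0; 0; 1]; [:: 0; 0; 1; -1; 0];
        [:: 1; -1; 0; 0; 0]; [:: 0; 0; 1; 1; -1]])%R);
  ([:: 0; 2; 4], [:: [::]; [::]; [:: 1]; [:: 0; 2]; [:: 0; 1; 2; 3]],
   ([:: [:: 0; 0; 0; 0; 1]; [:: 0; 0; 1; -1; 0];
        [:: 1; -1; 0; 0; 0]; [:: 1; 1; 0; 0; -1]])%R);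
  ([:: 0; 2; 3; 4], [:: [::]; [::]; [::]; [:: 0; 1]; [:: 2]; [:: 3; 4]],
   ([:: [:: 0; 0; 0; 0; 0; 1]; [:: 0; 0; 1; 0; -1; 0];
        [:: 0; 1; -1; 0; 0; 0]; [:: 0; 1; -1; -1; 1; 0]])%R);
  ([:: 0; 2; 3; 4],
   [:: [::]; [::]; [:: 0; 1]; [:: 0; 1; 2]; [:: 0; 1; 3]; [:: 0; 1; 3; 4]],
   ([:: [:: 0; 0; 0; 1; -1; 0]; [:: 0; 0; 1; 0; -1; 0];
        [:: 0; 1; 0; -1; 0; 0]; [:: 0; 1; 1; -1; 0; 0]])%R);
  ([:: 0; 1; 2; 4], [:: [::]; [::]; [:: 1]; [:: 0; 1]; [:: 2; 3]; [:: 2; 3; 4]],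
   ([:: [:: 0; 0; 0; 0; 0; 1]; [:: 0; 0; 1; -1; 0; 0];
        [:: 1; -1; 0; -1; 0; 1]; [:: 1; 1; 1; -1; -1; 0]])%R);
  ([:: 0; 1; 4], [:: [::]; [::]; [:: 0]; [:: 1; 2]; [:: 3]; [:: 3; 4]],
   ([:: [:: 0; 0; 0; 0; 0; 1]; [:: 0; 1; -1; 0; 0; 0];
        [:: 1; -1; -1; 1; 0; 0]; [:: 1; -1; -1; -1; 1; 1]])%R);
  ([:: 0; 2; 3], [:: [::]; [::]; [:: 0; 1]; [::]; [:: 0; 1]; [:: 3; 4]],
   ([:: [:: 0; 0; 0; 0; 0; 1]; [:: 0; 1; 0; 1; 0; -1];
        [:: 0; 0; 1; -1; -1; 1]; [:: 0; 1; -1; 1; 0; -1]])%R);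
  ([:: 0; 4], [:: [::]; [:: 0]; [:: 1]; [:: 2]; [:: 3]; [:: 3; 4]],
   ([:: [:: 0; 0; 1; 0; 0; 0]; [:: 0; 0; 0; 1; -1; 0];
        [:: 1; 0; -1; 0; 0; 1]; [:: 1; 1; -1; -1; 0; 1]])%R);
  ([:: 0; 2],
   [:: [::]; [:: 0]; [:: 1]; [:: 1; 2]; [:: 0; 2; 3]; [:: 0; 2; 3; 4]],
   ([:: [:: 0; 1; 0; 0; -1; 0]; [:: 1; 0; -1; 0; 0; 0];
        [:: 1; 1; -1; 0; 0; 0]; [:: 1; 1; 0; 1; -1; -1]])%R);
  ([:: 0; 2], [:: [::]; [:: 0]; [:: 1]; [:: 1; 2]; [:: 1]; [:: 1; 4]],
   ([:: [:: 1; 0; 0; 0; 0; 0]; [:: 1; 0; -1; 0; 0; 0];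
        [:: 1; 0; 0; 0; -1; 0]; [:: 1; 1; -1; 0; -1; 0]])%R);
  ([:: 4], [:: [::]; [::]; [::]; [::]; [:: 2; 3]; [:: 0; 1]],
   ([:: [:: 0; 0; 0; 0; 0; 1]; [:: 0; 0; 0; 0; 1; 0];
        [:: 0; 0; 1; 1; -1; 0]; [:: 1; 1; 0; 0; 0; -1]])%R);
  ([:: 0; 2], [:: [::]; [::]; [::]; [:: 1]; [:: 0]; [:: 2; 3; 4]],
   ([:: [:: 0; 0; 0; 0; 0; 1]; [:: 0; 0; 1; -1; 0; 0];
        [:: 0; 0; 1; 0; -1; 0]; [:: 0; 1; 0; -1; 0; 0]])%R);
  ([:: 0; 4], [:: [::]; [::]; [:: 1]; [:: 0]; [:: 2; 3]; [:: 2; 3; 4]],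
   ([:: [:: 0; 1; 0; 0; 0; 0]; [:: 1; 0; 0; 0; 0; 0];
        [:: 0; 1; 0; 1; -1; 0]; [:: 1; 1; 0; 0; -1; 0]])%R);
  ([:: 0; 2; 4; 6],
   [:: [::]; [::]; [::]; [::]; [:: 0; 1]; [:: 0; 1]; [:: 2; 3; 4; 5]],
   ([:: [:: 0; 0; 0; 1; 0; 0; 0]; [:: 0; 1; 0; 1; 0; 0; -1];
        [:: 0; 1; 1; 1; -1; 0; -1]; [:: 1; 1; 1; 1; -1; 0; -1]])%R);
  ([:: 0; 4], [:: [::]; [::]; [:: 1]; [:: 0]; [:: 2; 3]; [:: 0; 1; 4]],
   ([:: [:: 0; 0; 0; 0; 0; 1]; [:: 0; 0; 1; -1; 0; 0];
        [:: 0; 1; 0; 1; 0; -1]; [:: 1; 1; -1; -1; -1; 1]])%R);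
  ([:: 0; 6],
   [:: [::]; [::]; [:: 0; 1]; [:: 0; 1]; [:: 0; 1; 2; 3]; [:: 0; 1; 2; 3]; [:: 0; 1; 2; 3; 4; 5]],
   ([:: [:: 1; 1; -1; -1; 0; 0; 0]; [:: 1; 1; 1; 1; -2; -2; 0];
        [:: 0; 0; 0; 0; 0; 0; 1]; [:: 1; 1; 1; 1; 1; 1; -5]])%R);
  ([:: 0], [:: [::]; [::]; [:: 1]; [:: 0]; [:: 3]; [:: 2; 4]],
   ([:: [:: 0; 0; 0; 0; 0; 1]; [:: 1; 0; 0; 0; 0; 0];
        [:: 0; 0; 0; 1; -1; 0]; [:: 1; 0; 1; 0; -1; 0]])%R);
  ([:: 0], [:: [::]; [::]; [::]; [:: 1; 2]; [:: 0; 2]; [:: 0; 1]],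
   ([:: [:: 0; 0; 0; 0; 0; 1]; [:: 0; 0; 1; 0; 0; 0];
        [:: 0; 0; 0; 1; -1; 0]; [:: 0; 1; 0; -1; 0; 0]])%R)
].

(** Moves [r] to position 0, the vertex that [embeds] sends to the new vertex. *)
Definition reroot (F : seq (seq nat)) (W : seq (seq int)) (r : nat) :=
  let o := r :: rem r (iota 0 (size F)) in
  (mkseq (fun a => [seq b <- iota 0 a | row_adj F (nth 0 o a) (nth 0 o b)]) (size F),
   [seq [seq nth 0%R w i | i <- o] | w <- W]).

Definition forbidden_graphs : seq (seq (seq nat) * seq (seq int)) :=
  flatten [seq [seq reroot F.1.2 F.2 r | r <- F.1.1] | F <- forbidden_data].

Definition forbidden_tables :=
  [seq (F.1, tabulate (size F.1) (row_adj F.1)) | F <- forbidden_graphs].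

Definition template_tables :=
  [seq (T, tabulate (size T.1) (row_adj T.1)) | T <- templates].

(* Lower bounds for the numbers of vertices in the two cells of a class. *)
Definition class_splits (clique single : bool) : seq (nat * nat) :=
  if single then [:: (1, 0); (0, 1)]
  else if clique then [:: (1, 0); (0, 1); (1, 1)]
  else [:: (2, 0); (0, 2); (1, 1)].

Section Explore.
Variables (T : seq (seq nat) * seq nat) (M : seq (seq bool)).

Definition has_forbidden (m : seq nat) : bool :=
  let cs := nonempty_cells m in lazy_has (embeds M m cs) forbidden_tables.

(** The first two tests discard impossible counts: a singleton class whose size is not one, and a
    new vertex without neighbours. *)
Definition leaf (m : seq nat) : bool :=
  if has (fun a => nth 0 m a.*2.+1 + nth 0 m a.*2.+2 != 1) T.2 then true
  else if all (fun a => nth 0 m a.*2.+2 == 0) (iota 0 (size T.1)) then true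
  else lazy_has (merges M m) template_tables.

(* The counts in [s] are exact (capped at 2); a [1] in [s'] means [1] or more. *)
Fixpoint refine (s s' : seq nat) : bool :=
  if s' is x :: s'' then
    if x is 1 then
      if refine (rcons s 1) s'' then
        if has_forbidden (s ++ 2 :: s'') then true else refine (rcons s 2) s''
      else false
    else refine (rcons s x) s''
  else leaf s.

(** Classes not yet split contribute no vertices to [m], so a forbidden graph found early settles
    the whole branch. *)
Fixpoint explore (k : nat) (m : seq nat) : bool :=
  if has_forbidden m then true
  else if k is k'.+1 then
    let i := size T.1 - k in
    lazy_all (fun o : nat * nat => explore k' (m ++ [:: o.1; o.2]))
      (class_splits (row_adj T.1 i i) (i \in T.2))
  else refine [:: 1] (behead m).

End Explore.

Definition check_template (T : seq (seq nat) * seq nat) : bool :=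
  explore T (tabulate (size T.1).*2.+1 (split_adj T.1)) (size T.1) [:: 1].

Lemma check_templates : lazy_all check_template templates.
Proof. vm_cast_no_check (erefl true). Qed.

(** * Positivity certificates for the forbidden graphs *)

Definition int_sum (n : nat) (f : nat -> int) : int :=
  foldr (fun i s => (f i + s)%R) 0%R (iota 0 n).

Lemma int_sumE n f : int_sum n f = (\sum_(i < n) f i)%R.
Proof. by rewrite -(big_mkord xpredT f) /index_iota subn0 unlock. Qed.

Lemma all_iota (p : pred nat) n i : all p (iota 0 n) -> i < n -> p i.
Proof. by move=> /allP p_all ni; apply: p_all; rewrite mem_iota. Qed.

Section Certificate.
Variable F : seq (seq nat).

Definition int_nbr_sum (w : seq int) (b : nat) : int :=
  int_sum (size F) (fun a => if (b != a) && row_adj F b a then nth 0%R w a else 0%R).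

Definition int_form (w w' : seq int) : int :=
  int_sum (size F) (fun b => ((int_nbr_sum w b + nth 0 w b) * int_nbr_sum w' b)%R).

Definition positive_certificate (W : seq (seq int)) : bool :=
  all (fun i => all (fun j =>
    let x := int_form (nth [::] W i) (nth [::] W j) in
    if i == j then (0 < x)%R else (x == 0)%R) (iota 0 4)) (iota 0 4).

Definition induces (H : sgraph) :=
  exists2 f : 'I_(size F) -> H, injective f &
    forall a b, a != b -> adj (f a) (f b) = row_adj F a b.

Lemma induced_rank (H : sgraph) W :
  positive_certificate W -> induces H ->
  (3 < walk_rank H)%N.
Proof.
move=> cert [f f_inj fE].
pose w (i : 'I_4) (a : 'I_(size F)) : rat := (nth 0 (nth [::] W i) a)%:~R%R.
have nbE (i : 'I_4) b : (\sum_a (adj (f b) (f a))%:R * w i a =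
    (int_nbr_sum (nth [::] W i) b)%:~R)%R.
  rewrite /int_nbr_sum int_sumE rmorph_sum; apply: eq_bigr => a _ /=.
  have [/val_inj -> | ba] := eqVneq (b : nat) a; first by rewrite adj_irr mul0r.
  by rewrite fE //; case: row_adj; rewrite ?mul1r ?mul0r.
have qE (i j : 'I_4) : (\sum_b (\sum_a (adj (f b) (f a))%:R * w i a + w i b) *
      \sum_a (adj (f b) (f a))%:R * w j a =
      (int_form (nth [::] W i) (nth [::] W j))%:~R)%R.
  rewrite /int_form int_sumE rmorph_sum; apply: eq_bigr => b _.
  by rewrite !nbE rmorphM rmorphD.
have {}cert (i j : 'I_4) :
    let x := int_form (nth [::] W i) (nth [::] W j) in
    if i == j then (0 < x)%R else (x == 0)%R.
  exact: all_iota (all_iota cert (ltn_ord i)) (ltn_ord j).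
apply: (positive_subspace (W := w)) f_inj _ _ => [i | i j /negPf ij].
  by rewrite qE ltr0z; have := cert i i; rewrite eqxx.
by rewrite qE; have := cert i j; rewrite ij => /eqP ->.
Qed.

End Certificate.

Lemma forbidden_certificates :
  all (fun FW => positive_certificate FW.1 FW.2) forbidden_graphs.
Proof. by vm_compute. Qed.

(** * Lifting patterns of cells to vertices *)

Section Cells.
Variables (H : sgraph) (X : {set H}) (c : H -> nat).

Definition cell_size j := #|[set x in X | c x == j]|.

(** Greedy choice: cell [j] has more vertices than the tail of [e] uses in it. *)
Lemma pick_vertices (e : seq nat) :
  (forall j, count_mem j e <= cell_size j) ->
  exists us : seq H, [/\ uniq us, {subset us <= X} & map c us = e].
Proof.
elim: e => [|j e IH] e_le; first by exists [::].
have [k|us [us_uniq usX cus]] := IH; first by rewrite (leq_trans _ (e_le k)) //= leq_addl.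
have : ~~ ([set x in X | c x == j] \subset us).
  apply/negP => sub; have := e_le j; rewrite /= eqxx ltnNge => /negP; apply.
  rewrite -cus count_map -size_filter.
  have := filter_uniq (preim c (pred1 j)) us_uniq => /card_uniqP <-.
  apply: subset_leq_card; apply/subsetP => x xj; rewrite mem_filter (subsetP sub) // andbT.
  by move: xj; rewrite inE => /andP [].
case/subsetPn => u; rewrite inE => /andP [uX /eqP cu] uus.
exists (u :: us); rewrite /= us_uniq uus cus cu; split=> // x.
by rewrite inE => /predU1P [->|/usX].
Qed.

Variable M : seq (seq bool).
Hypothesis adjE : {in X &, forall x y, x != y -> adj x y = table_adj M (c x) (c y)}.

Lemma has_forbidden_rank (v : H) m :
  (forall j, nth 0 m j <= cell_size j) -> has_forbidden M m ->
  3 < walk_rank H.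
Proof.
move=> m_le; rewrite /has_forbidden lazy_hasE => /hasP [_ /mapP [FW FWin ->]].
case/search_goal => e /and3P [/eqP /= size_e /allP e_le eE].
apply: (induced_rank (allP forbidden_certificates _ FWin)).
have [j|us [us_uniq usX cus]] := @pick_vertices e.
  have [je|/count_memPn ->//] := boolP (j \in e).
  exact: leq_trans (e_le j je) (m_le j).
have size_us : size us = size FW.1 by rewrite -size_e -cus size_map.
have lt_us (a : 'I_(size FW.1)) : a < size us by rewrite size_us.
have cE (a : 'I_(size FW.1)) : c (nth v us a) = nth 0 e a by rewrite -cus (nth_map v).
exists (fun a => nth v us a) => [a b /eqP|a b ab].
  by rewrite nth_uniq // => /eqP /val_inj.
have ab' : (a : nat) == b = false by apply/negbTE.
rewrite adjE ?usX ?mem_nth ?nth_uniq ?ab' // !cE.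
by have := all_iota (all_iota eE (ltn_ord a)) (ltn_ord b); rewrite ab' => /eqP.
Qed.
End Cells.

(** * Soundness of the search *)

Section ExploreSound.
Variables (T : seq (seq nat) * seq nat) (M : seq (seq bool)) (s0 : seq nat).
Hypothesis no_forbidden : forall m,
  (forall j, nth 0 m j <= nth 0 s0 j) -> ~~ has_forbidden M m.
Hypothesis s0_le2 : forall j, nth 0 s0 j <= 2.

(** For counts capped at two, the lower bounds 0 and 2 are exact, and 1 means nonempty. *)
Definition bounds (x y : nat) := (x <= y) && ((x == 0) == (y == 0)).

Lemma size_bounds s s' : all2 bounds s s' -> size s = size s'.
Proof. by rewrite all2E => /andP [/eqP]. Qed.

Lemma nth_bounds s s' j : all2 bounds s s' -> nth 0 s j <= nth 0 s' j.
Proof.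
elim: s s' j => [|x s IH] [|y s'] //= j /andP [/andP [xy _] /IH {}IH].
by case: j.
Qed.

(** [s0] holds the true capped counts, and the branch of [refine] matching them is followed; by
    [no_forbidden] it cannot stop before a leaf. *)
Lemma refine_sound s s' s1 :
  s0 = s ++ s1 -> all2 bounds s' s1 -> refine T M s s' -> leaf T M s0.
Proof.
elim: s' s s1 => [|x s' IH] s [|y s1] //; first by rewrite cats0 => ->.
move=> s0E /= /andP [/andP [xy x0] s's1].
have y2 : y <= 2 by have := s0_le2 (size s); rewrite s0E nth_cat ltnn subnn.
have rec z : z = y -> refine T M (rcons s z) s' -> leaf T M s0.
  by move=> ->; apply: IH s's1; rewrite cat_rcons.
case: (x =P 1) => [x1 | x1]; last first.
  move=> r_s; apply: (rec x); first by lia.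
  by move: r_s x1; case: (x) => [|[|]].
rewrite x1 /= in xy x0 *; case: ifP => // r1.
case: (y =P 1) => [y1 _|y1]; first exact: rec r1.
have y2' : y = 2 by lia.
rewrite (negPf (no_forbidden _)); first by apply: rec.
move=> j; rewrite s0E y2' !nth_cat; case: ltnP => // _.
by case: (j - size s) => //= k; apply: nth_bounds.
Qed.

Variable count : nat -> nat * nat.
Hypothesis count_split : forall i, i < size T.1 ->
  exists2 o, o \in class_splits (row_adj T.1 i i) (i \in T.2) &
    bounds o.1 (count i).1 && bounds o.2 (count i).2.

(** At each class the split bounding the true counts is followed. Every [m] on this branch is below
    [s0], so no forbidden graph is found. *)
Lemma explore_sound k m s :
  k <= size T.1 ->
  s0 = 1 :: s ++
    flatten [seq [:: (count i).1; (count i).2] | i <- iota (size T.1 - k) k] ->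
  all2 bounds m s -> explore T M k (1 :: m) -> leaf T M s0.
Proof.
elim: k m s => [|k IH] m s kn s0E ms /=.
  rewrite (negPf (no_forbidden _)); last first.
    move=> j; rewrite s0E cats0; exact: (nth_bounds (s := 1 :: m) (s' := 1 :: s)).
  by apply: refine_sound ms; rewrite s0E cats0.
rewrite (negPf (no_forbidden _)); last first.
  move=> j; rewrite s0E -cat_cons nth_cat; case: ltnP => js.
    exact: (nth_bounds (s := 1 :: m) (s' := 1 :: s)).
  by rewrite nth_default //= (size_bounds ms).
have i_lt : size T.1 - k.+1 < size T.1 by lia.
have [o o_in o_ok] := count_split i_lt.
rewrite lazy_allE => /allP /(_ o o_in).
set p := count _ in o_ok.
apply: (IH (m ++ [:: o.1; o.2]) (s ++ [:: p.1; p.2])); first exact: ltnW.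
  rewrite s0E -catA /=; have -> : (size T.1 - k.+1).+1 = size T.1 - k by lia.
  by [].
have sz := size_bounds ms; move: ms; rewrite !all2E => /andP [_ ms].
by rewrite !size_cat sz eqxx zip_cat // all_cat ms /= andbT.
Qed.

End ExploreSound.

(** * Classification by adding one vertex at a time *)

Lemma flatten_pairs (h : nat -> nat) i k :
  flatten [seq [:: h j.*2.+1; h j.*2.+2] | j <- iota i k] =
  [seq h j | j <- iota i.*2.+1 k.*2].
Proof. by elim: k i => //= k IH i; rewrite IH. Qed.

Lemma templates_singles : all (fun T => all (fun a => a < size T.1) T.2) templates.
Proof. by vm_compute. Qed.

(** Since classes that are not cliques have two vertices or more, every singleton class counts as a
    clique. *)
Definition classified (H : sgraph) (T : seq (seq nat) * seq nat) (S : {set H})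
    (c : H -> nat) : Prop :=
  [/\ {in S, forall x, c x < size T.1},
      forall a, a < size T.1 -> 0 < cell_size S c a,
      {in S &, forall x y, x != y -> adj x y = row_adj T.1 (c x) (c y)},
      forall a, a < size T.1 -> row_adj T.1 a a || (1 < cell_size S c a)
    & forall a, a \in T.2 -> cell_size S c a = 1].

(** The class map is the merging composed with [cell]. Counts capped at two still tell whether a
    cell contains a pair of vertices. *)
Lemma classified_merging (H : sgraph) (X : {set H}) (cell : H -> nat) M m T g :
  {in X &, forall x y, x != y -> adj x y = table_adj M (cell x) (cell y)} ->
  {in X, forall x, cell x < size m} ->
  (forall j, nth 0 m j = if j < size m then minn 2 (cell_size X cell j) else 0) ->
  all (fun a => a < size T.1) T.2 -> is_merging M m T g ->
  exists c, classified T X c.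
Proof.
move=> adjE cell_lt mE /allP T2_lt; rewrite /is_merging; set cs := nonempty_cells m.
pose f j := nth 0 g (index j cs); rewrite -/f.
case/and5P => /allP f_lt f_onto /allP f_adj f_coclique /allP f_single.
have csP j : (j \in cs) = (0 < nth 0 m j).
  rewrite mem_filter mem_iota /= add0n andbC; case: ltnP => // jm.
  by rewrite nth_default.
have csX x : x \in X -> cell x \in cs.
  move=> xX; rewrite csP mE cell_lt // leq_min /=; apply/card_gt0P; exists x.
  by rewrite inE xX /=.
have csI j : j \in cs -> exists2 x, x \in X & cell x = j.
  rewrite csP mE; case: ifP => // _; rewrite leq_min => /andP [_ /card_gt0P [x]].
  by rewrite inE => /andP [xX /eqP xj]; exists x.
have cs2 x y : x \in X -> y \in X -> x != y -> cell x = cell y -> 1 < nth 0 m (cell x).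
  move=> xX yX xy cxy; rewrite mE cell_lt // leq_min /=; apply/card_gt1P; exists x, y.
  by rewrite !inE xX yX cxy eqxx.
exists (f \o cell); split.
- by move=> x xX; exact: (f_lt _ (csX _ xX)).
- move=> a /(all_iota f_onto) /hasP [j /csI [x xX <-] fa].
  by apply/card_gt0P; exists x; rewrite inE xX.
- move=> x y xX yX xy; rewrite adjE //.
  have /allP /(_ _ (csX _ yX)) := f_adj _ (csX _ xX).
  case/orP => [/andP [/eqP /(cs2 _ _ xX yX xy)]|/eqP -> //].
  by rewrite ltnNge => /negPf ->.
- move=> a /(all_iota f_coclique) /orP [->//|].
  case/hasP => j jcs /hasP [k kcs /and3P [/eqP fj /eqP fk jk]]; apply/orP; right.
  rewrite -/(f j) -/(f k) in fj fk.
  have [x xX xj] := csI _ jcs; have [y yX yk] := csI _ kcs.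
  case: (eqVneq j k) jk => [jk /= |jk _]; last first.
    apply/card_gt1P; exists x, y; rewrite !inE xX yX /= xj yk fj fk eqxx.
    by split=> //; apply: contraNneq jk => xy; rewrite -xj -yk xy.
  rewrite mE; case: ifP => // _; rewrite leq_min /= => /card_gt1P [x' [y' []]].
  rewrite !inE => /andP [x'X /eqP x'j] /andP [y'X /eqP y'j] xy'.
  by apply/card_gt1P; exists x', y'; rewrite !inE x'X y'X /= x'j y'j fj eqxx.
(* Two vertices of a required singleton would share a cell whose count is at most one. *)
move=> a aT; apply/eqP; rewrite eqn_leq; apply/andP; split.
  apply/card_le1P => x; rewrite inE => /andP [xX /eqP fx] y.
  rewrite !inE; apply/andP/eqP => [[yX /eqP fy]|->]; last by rewrite xX fx.
  apply/eqP; apply: contraT; rewrite eq_sym => xy.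
  have /allP /(_ _ (csX _ xX)) /allP /(_ _ (csX _ yX)) := f_single a aT.
  rewrite -/(f _) -/(f _); move: fx fy => /= -> ->; rewrite eqxx /=.
  case/andP => /eqP /(cs2 _ _ xX yX xy).
  by rewrite ltnNge => /negPf ->.
have /hasP [j /csI [x xX <-] fa] := all_iota f_onto (T2_lt a aT).
by apply/card_gt0P; exists x; rewrite inE xX.
Qed.

Section AddVertex.
Variables (H : sgraph) (T : seq (seq nat) * seq nat).
Variables (S : {set H}) (c : H -> nat) (v : H).
Hypotheses (ST : classified T S c) (vS : v \notin S).

Let X := v |: S.

Definition split_cell (x : H) : nat := if x == v then 0 else (c x).*2.+1 + adj v x.

Lemma split_cell_lt : {in X, forall x, split_cell x < (size T.1).*2.+1}.
Proof.
have [c_lt _ _ _ _] := ST; move=> x; rewrite /split_cell in_setU1.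
by case: eqP => //= _ /c_lt; case: adj; lia.
Qed.

Lemma split_cell_adj :
  {in X &, forall x y, x != y -> adj x y =
     table_adj (tabulate (size T.1).*2.+1 (split_adj T.1))
       (split_cell x) (split_cell y)}.
Proof.
have [_ _ adjE _ _] := ST; move=> x y xX yX xy.
rewrite tabulateE ?split_cell_lt // /split_cell /split_adj.
move: xX yX xy; rewrite !in_setU1; case: (eqVneq x v) => [->|xv] /=.
  by case: (eqVneq y v) => [->|yv] //= _ yS _; rewrite oddD odd_double; case: adj.
case: (eqVneq y v) => [->|yv] //= xS yS xy; first by rewrite oddD odd_double adj_sym; case: adj.
by rewrite adjE // ![_.*2 + _]addnC !half_bit_double.
Qed.

Lemma split_cell_size i (b : bool) : cell_size X split_cell (i.*2.+1 + b) =
  #|[set x in S | (c x == i) && (adj v x == b)]|.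
Proof.
apply: eq_card => x; rewrite !inE /split_cell.
case: (eqVneq x v) => [->|xv] /=; first by rewrite (negPf vS); case: b.
by congr (_ && _); case: b; case: adj; lia.
Qed.

Lemma split_cell_size0 : cell_size X split_cell 0 = 1.
Proof.
apply/eqP/cards1P; exists v; apply/setP => x; rewrite !inE /split_cell.
by case: (eqVneq x v) => //= _; rewrite andbF.
Qed.

Lemma split_cell_sum i :
  cell_size X split_cell i.*2.+1 + cell_size X split_cell i.*2.+2 = cell_size S c i.
Proof.
have := split_cell_size i false; rewrite addn0 => ->.
have := split_cell_size i true; rewrite addn1 => ->.
rewrite /cell_size -[RHS](cardsID [set x | ~~ adj v x]); congr (_ + _);
  by apply: eq_card => x; rewrite !inE; case: adj; rewrite ?andbT ?andbF.
Qed.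

Definition split_counts : seq nat :=
  mkseq (fun j => minn 2 (cell_size X split_cell j)) (size T.1).*2.+1.

Lemma nth_split_counts j : nth 0 split_counts j =
  if j < size split_counts then minn 2 (cell_size X split_cell j) else 0.
Proof.
rewrite /split_counts size_mkseq.
by case: ltnP => j_lt; [rewrite nth_mkseq | rewrite nth_default ?size_mkseq].
Qed.

Lemma split_counts_leaf :
  (walk_rank H <= 3)%N -> T \in templates ->
  leaf T (tabulate (size T.1).*2.+1 (split_adj T.1)) split_counts.
Proof.
move=> rk T_in; have [_ c_onto _ c_coclique c_single] := ST.
have := check_templates; rewrite lazy_allE => /allP /(_ _ T_in).
pose capped j := minn 2 (cell_size X split_cell j).
apply: (@explore_sound _ _ _ _ _
  (fun i => (capped i.*2.+1, capped i.*2.+2)) _ _ _ [::]) => //.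
(* A forbidden graph for any counts below the true ones would force rank at least 4. *)
- move=> m m_le; apply/negP => /(has_forbidden_rank split_cell_adj v) bad.
  suff : 3 < 3 by [].
  apply: leq_trans rk; apply: bad => j; rewrite (leq_trans (m_le j)) //.
  by rewrite nth_split_counts; case: ifP => // _; apply: geq_minr.
- by move=> j; rewrite nth_split_counts; case: ifP => // _; apply: geq_minl.
- move=> i i_lt; have := split_cell_sum i; have := c_onto i i_lt.
  have := c_coclique i i_lt; rewrite /class_splits /capped.
  set n := cell_size S c i; set p := cell_size _ _ _; set q := cell_size _ _ _.
  case: ifP => [/c_single|_]; rewrite -/n.
    move=> -> _ _; case: p => [|[|p]] pq; [exists (0, 1)|exists (1, 0)|];
      rewrite ?inE //= /bounds; lia.
  case: row_adj => /= [_|] n_gt pq.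
    exists ((0 < p) : nat, (0 < q) : nat); last first.
      by rewrite /bounds /=; case: (p) => //; case: (q); lia.
    by move: n_gt pq; case: (p) => [|?]; case: (q) => [|?]; rewrite !inE //=; lia.
  (* A coclique class has at least two vertices, so if one cell is empty the other contains two. *)
  exists (if q == 0 then (2, 0) else if p == 0 then (0, 2) else (1, 1)).
    by case: eqP => //; case: eqP.
  by rewrite /bounds; case: eqP => [q0|q0] /=; [lia|case: eqP => [p0|p0] /=; lia].
rewrite subnn (flatten_pairs capped).
by rewrite /split_counts /mkseq /= split_cell_size0.
Qed.

(** Of the three ways in which [leaf] succeeds, the first contradicts the size of a singleton class,
    the second the neighbour [x0], and the third provides [T']. *)
Lemma classified_add x0 :
  (walk_rank H <= 3)%N -> T \in templates ->
  x0 \in S -> adj v x0 ->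
  exists2 T', T' \in templates & exists c', classified T' X c'.
Proof.
move=> rk T_in x0S x0v; have := split_counts_leaf rk T_in.
have [c_lt _ _ _ c_single] := ST.
rewrite /leaf; case: ifP => [/hasP [a aT]|_].
  have a_lt := allP (allP templates_singles _ T_in) _ aT.
  rewrite !nth_split_counts size_mkseq !ifT ?ltnS; try lia.
  have := split_cell_sum a; rewrite c_single //.
  by move: (cell_size _ _ _) (cell_size _ _ _) => p q; lia.
case: ifP => [all0|_].
  have := all_iota all0 (c_lt _ x0S); rewrite nth_split_counts size_mkseq ifT;
    last by have := c_lt _ x0S; lia.
  have : 0 < cell_size X split_cell (c x0).*2.+2.
    have := split_cell_size (c x0) true; rewrite addn1 => ->.
    by apply/card_gt0P; exists x0; rewrite !inE x0S x0v !eqxx.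
  move=> p_gt0 /eqP p0 _; exfalso.
  move: p_gt0 p0; move: (cell_size _ _ _) => p; lia.
rewrite lazy_hasE => /hasP [_ /mapP [T' T'_in ->]] /search_goal [g merging].
exists T' => //; apply: classified_merging merging; first exact: split_cell_adj.
- by move=> x xX; rewrite size_mkseq split_cell_lt.
- exact: nth_split_counts.
exact: (allP templates_singles _ T'_in).
Qed.

End AddVertex.

Lemma connected_classified (H : sgraph) :
  0 < #|H| -> graph_connected H -> (walk_rank H <= 3)%N ->
  exists2 T, T \in templates & exists c, classified T [set: H] c.
Proof.
move=> /card_gt0P [v0 _] conn rk.
suff step n : n < #|H| -> exists2 S : {set H}, #|S| = n.+1 &
    exists2 T, T \in templates & exists c, classified T S c.
  have H_gt0 : 0 < #|H| by apply/card_gt0P; exists v0.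
  have [|S cS] := step #|H|.-1; first by rewrite prednK.
  rewrite prednK // in cS.
  by have <- : S = setT by apply/eqP; rewrite eqEcard subsetT cardsT cS leqnn.
elim: n => [|n IH] n_le.
  exists [set v0]; first by rewrite cards1.
  exists (nth ([::], [::]) templates 0); first exact: mem_nth.
  exists (fun=> 0); split=> //=.
  - case=> // _; rewrite /cell_size; apply/card_gt0P; exists v0; by rewrite !inE eqxx.
  - by move=> x y; rewrite !inE => /eqP -> /eqP ->; rewrite eqxx.
  by case.
have [S cS [T T_in [c ST]]] := IH (ltnW n_le).
have [x0 x0S] : exists x0, x0 \in S by apply/card_gt0P; rewrite cS.
have [v1 v1S] : exists v, v \notin S.
  apply/existsP; rewrite -negb_forall; apply: contraL n_le => /forallP allS.
  have -> : #|H| = #|S| by rewrite -cardsT; apply: eq_card => x; rewrite inE allS.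
  by rewrite cS ltnn.
(* Take the first vertex outside [S] on a path from [x0] to [v1]. *)
have [v vS [x xS vx]] : exists2 v, v \notin S & exists2 x, x \in S & adj v x.
  have /connectP [p] := conn x0 v1.
  elim: p x0 x0S => [|y p IHp] x0 x0S /=; first by move=> _ v1x; rewrite v1x x0S in v1S.
  case/andP => x0y yp v1p; case: (boolP (y \in S)) => yS; first exact: IHp yp v1p.
  by exists y => //; exists x0; rewrite // adj_sym.
exists (v |: S); first by rewrite cardsU1 vS cS.
exact: classified_add ST vS _ rk T_in xS vx.
Qed.

(** * Rank of mixed extensions *)

Local Open Scope ring_scope.

(** A mixed extension given by its map to [G]: fibres replace the dependent pairs of
    [mixed_vertex]. *)
Definition blowup (H G : sgraph) (t : G -> int) (c : H -> G) : Prop :=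
  (forall i, #|[set x | c x == i]| = `|t i|%N) /\
  (forall x y, adj x y = if c x == c y then (0 < t (c x)) && (x != y)
                         else adj (c x) (c y)).

(** The isomorphism sends a vertex to its index within its fibre; it is injective between sets of
    equal size. *)
Lemma blowup_mixed (H G : sgraph) (t : G -> int) (c : H -> G) :
  (forall i, t i != 0) -> blowup t c -> is_mixed_extension_of_type H t.
Proof.
move=> t0 [sz adjE]; split=> //.
pose cls i := enum [set x | c x == i].
have lt x : (index x (cls (c x)) < `|t (c x)|)%N.
  by rewrite -sz cardE index_mem mem_enum inE.
pose f x : mixed_extension t := Tagged (fun i => 'I_(`|t i|%N)) (Ordinal (lt x)).
have f_inj : injective f.
  move=> x y fxy.
  have cxy : c x = c y by have := congr1 tag fxy.
  have : index x (cls (c x)) = index y (cls (c x)).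
    rewrite {2}cxy; exact: (congr1 (fun u : mixed_extension t => val (tagged u)) fxy).
  by move=> /(index_inj x); apply; rewrite /cls mem_enum inE ?cxy.
exists f.
  apply: inj_card_bij => //.
  rewrite card_tagged sumnE big_map big_enum /= -(sum1_card H) (partition_big c xpredT) //=.
  by apply: leq_sum => i _; rewrite card_ord -sz sum1dep_card.
move=> x y; rewrite /= /mixed_adj /= adjE.
by rewrite (inj_eq f_inj).
Qed.

Lemma mixed_blowup (H G : sgraph) (t : G -> int) :
  is_mixed_extension_of_type H t ->
  (forall i, t i != 0) /\ exists c : H -> G, blowup t c.
Proof.
case=> t0 [f f_bij fE]; split=> //; exists (fun x => tag (f x)); split=> [i|x y].
  pose B := [set u : mixed_extension t | tag u == i].
  have -> : [set x | tag (f x) == i] = f @^-1: B by apply/setP => x; rewrite !inE.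
  rewrite on_card_preimset; last exact: onW_bij.
  pose g (k : 'I_(`|t i|%N)) : mixed_extension t := Tagged (fun i => 'I_(`|t i|%N)) k.
  have -> : B = [set g k | k : 'I_(`|t i|%N)].
    apply/setP => u; rewrite inE; apply/eqP/imsetP => [|[k _ ->] //].
    by case: u => j k /= ji; subst j; exists k.
  rewrite card_imset ?cardsT ?card_ord // => k l /eqP.
  by rewrite -tag_eqE /tag_eq eqxx /= tagged_asE => /eqP.
rewrite -fE /= /mixed_adj; case: eqP => // _.
by rewrite (inj_eq (bij_inj f_bij)).
Qed.

(* The sign of [t i] is immaterial when [t i = 1] or [-1]. *)
Lemma blowup_resign (H G : sgraph) (t t' : G -> int) (c : H -> G) :
  (forall i, `|t' i|%N = `|t i|%N) ->
  (forall i, (1 < `|t i|)%N -> (0 < t' i) = (0 < t i)) ->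
  blowup t c -> blowup t' c.
Proof.
move=> tt' sgn [sz adjE]; split=> [i|x y]; first by rewrite tt'.
rewrite adjE; case: (eqVneq (c x) (c y)) => // cxy.
case: (eqVneq x y) => [|xy]; first by rewrite !andbF.
rewrite sgn //; rewrite -sz; apply/card_gt1P; exists x, y.
by rewrite !inE cxy eqxx.
Qed.

Section Blowup.
Variables (H G : sgraph) (t : G -> int) (c : H -> G).
Hypotheses (t0 : forall i, t i != 0) (Htc : blowup t c).

Let size_gt0 i : (0 < `|t i|)%N. Proof. by rewrite absz_gt0. Qed.

Lemma blowup_onto i : exists u, c u == i.
Proof.
have [sz _] := Htc; have := size_gt0 i; rewrite -sz => /card_gt0P [u].
by rewrite inE; exists u.
Qed.

Definition rep i : H := xchoose (blowup_onto i).
Lemma repK i : c (rep i) = i. Proof. exact/eqP/(xchooseP (blowup_onto i)). Qed.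

(* [- lam] is added to the diagonal of the quotient matrix; the factor
   [1 / |t|] makes the matrix symmetric. *)
Definition quotient_diag (lam : rat) (z : int) : rat :=
  ((if 0 < z then (`|z|%N)%:R - 1 else 0) - lam) / (`|z|%N)%:R.

Definition spread (w : G -> rat) (u : H) : rat := w (c u) / (`|t (c u)|%N)%:R.

(** Summing [w i / |t i|] over class [i] gives [w i], so only the entries of [G] appear off the
    diagonal. In a clique a vertex misses itself, whence the [|t| - 1] in [quotient_diag]. *)
Lemma nbr_sum_spread lam w u :
  nbr_sum (spread w) u - lam * spread w u =
  \sum_i (adj (c u) i)%:R * w i + quotient_diag lam (t (c u)) * w (c u).
Proof.
have [sz adjE] := Htc.
have n0 i : (`|t i|%N)%:R != 0 :> rat by rewrite pnatr_eq0 -lt0n.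
rewrite /nbr_sum (partition_big c xpredT) //= [X in _ = X + _](bigD1 (c u)) //= adj_irr mul0r add0r.
rewrite (bigD1 (c u)) //=.
have -> : \sum_(v | c v == c u) (adj u v)%:R * spread w v =
    (if 0 < t (c u) then (`|t (c u)|%N)%:R - 1 else 0) * spread w u.
  rewrite (eq_bigr (fun v => ((0 < t (c u)) && (v != u))%:R * spread w u)); last first.
    by move=> v /eqP cv; rewrite adjE cv eqxx /spread cv eq_sym.
  rewrite -big_distrl /=; congr (_ * _); case: ifP => _; last by rewrite big1.
  rewrite (bigD1 u) //= eqxx add0r -sz (cardsD1 u) inE eqxx add1n -[in RHS]addn1 natrD addrK.
  rewrite -sum1_card natr_sum; apply: eq_big => v; first by rewrite !inE andbC.
  by case/andP=> _ ->.
rewrite (eq_bigr (fun i => (adj (c u) i)%:R * w i)); last first.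
  move=> i iu; rewrite (eq_bigr (fun=> (adj (c u) i)%:R * (w i / (`|t i|%N)%:R))); last first.
    by move=> v /eqP cv; rewrite adjE cv eq_sym (negPf iu) /spread cv.
  rewrite sumr_const -[#|_|](cardsE) sz -mulr_natr; field; exact: n0.
rewrite /spread /quotient_diag.
set a := (if _ then _ else _); set s := \sum_(i | _) _; field; exact: n0.
Qed.

End Blowup.

Lemma sum_walk (H : sgraph) (y : H -> rat) z :
  \sum_u y u * walk u z = shift_sum y z.
Proof.
rewrite /shift_sum /nbr_sum; under eq_bigr do rewrite /walk mulrDr big_distrr /=.
under [RHS]eq_bigr do rewrite mulrDr big_distrr /=.
rewrite !big_split /= exchange_big /=; congr (_ + _); last first.
  by apply: eq_bigr => u _; rewrite adj_sym mulrC.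
apply: eq_bigr => v _; apply: eq_bigr => u _.
by rewrite [adj u v]adj_sym [adj v z]adj_sym; ring.
Qed.

Section BlowupRank.
Variables (H G : sgraph) (t : G -> int) (c : H -> G).
Hypotheses (t0 : forall i, t i != 0) (Htc : blowup t c).

Let rep i : H := rep t0 Htc i.
Let repK i : c (rep i) = i := repK t0 Htc i.

(** Vertices of one class have equal rows in [A + 1] for a clique and in [A] for a coclique, and
    [A^2 + A] is both [(A + 1) A] and [A (A + 1)]. *)
Lemma walk_twins u u' z : c u = c u' -> walk u z = walk u' z.
Proof.
have [_ adjE] := Htc; move=> cu.
have [t_gt0|t_le0] := boolP (0 < t (c u)).
  have walkE x : walk x z = \sum_v ((adj x v)%:R + (x == v)%:R) * (adj v z)%:R.
    rewrite /walk; under [RHS]eq_bigr do rewrite mulrDl.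
    rewrite big_split /=; congr (_ + _); rewrite (bigD1 x) //= eqxx mul1r big1 ?addr0 // => v vx.
    by rewrite eq_sym (negPf vx) mul0r.
  rewrite !walkE; apply: eq_bigr => v _; congr (_ * _).
  rewrite !adjE -cu; case: eqP => cuv; rewrite ?t_gt0 /=.
    by do 2 case: eqP.
  by case: (u =P v) cuv => [->|] //; case: (u' =P v) => [<-|] //; rewrite cu.
have walkE x : walk x z = \sum_v (adj x v)%:R * ((adj v z)%:R + (v == z)%:R).
  rewrite /walk; under [RHS]eq_bigr do rewrite mulrDr.
  rewrite big_split /=; congr (_ + _); rewrite (bigD1 z) //= eqxx mulr1 big1 ?addr0 // => v vx.
  by rewrite (negPf vx) mulr0.
rewrite !walkE; apply: eq_bigr => v _; congr (_ * _).
by rewrite !adjE -cu (negPf t_le0).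
Qed.

Lemma walk_rep u z : walk u z = walk (rep (c u)) z.
Proof. by apply: walk_twins; rewrite repK. Qed.

Lemma blowup_rank : (walk_rank H <= #|G|)%N.
Proof.
apply: (rank_le_span (r := fun i => rep (enum_val i))
                     (a := fun u i => (i == enum_rank (c u))%:R)) => u z.
rewrite (bigD1 (enum_rank (c u))) //= eqxx mul1r enum_rankK -walk_rep big1 ?addr0 // => i ic.
by rewrite (negPf ic) mul0r.
Qed.

Lemma blowup_rank_span k (r : 'I_k -> G) (a : G -> 'I_k -> rat) :
  (forall j z, walk (rep j) z = \sum_i a j i * walk (rep (r i)) z) ->
  (walk_rank H <= k)%N.
Proof.
move=> aE; apply: (rank_le_span (r := rep \o r) (a := fun u => a (c u))) => u z.
by rewrite walk_rep aE.
Qed.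

(** A kernel vector of the quotient matrix spreads to an eigenvector for 0 or -1, which [A^2 + A]
    kills. Grouping its entries by class gives a relation between the representative rows. *)
Lemma walk_dependency lam w z : lam * (lam + 1) = 0 ->
  (forall j, \sum_i (adj j i)%:R * w i + quotient_diag lam (t j) * w j = 0) ->
  \sum_i w i * walk (rep i) z = 0.
Proof.
move=> lam01 ker; pose y := spread t c w.
have n0 i : (`|t i|%N)%:R != 0 :> rat by rewrite pnatr_eq0 absz_eq0.
have nyE u : nbr_sum y u = lam * y u.
  by apply/eqP; rewrite -subr_eq0 (nbr_sum_spread t0 Htc) ker.
transitivity (\sum_u y u * walk u z).
  rewrite (partition_big c xpredT) //=; apply: eq_bigr => i _.
  rewrite (eq_bigr (fun=> w i / (`|t i|%N)%:R * walk (rep i) z)); last first.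
    by move=> u /eqP cu; rewrite walk_rep cu /y /spread cu.
  have [sz _] := Htc; rewrite sumr_const -[#|_|]cardsE sz -mulr_natr; field; exact: n0.
rewrite sum_walk /shift_sum /nbr_sum.
rewrite (eq_bigr (fun v => (lam + 1) * ((adj z v)%:R * y v))).
  rewrite -big_distrr /= -/(nbr_sum y z) nyE mulrA [_ * lam]mulrC lam01 mul0r //.
by move=> v _; rewrite -/(nbr_sum y v) nyE; ring.
Qed.

End BlowupRank.

(** The equation says that the tridiagonal matrix with diagonal [x 0, ..., x 3] and ones beside it
    is singular. *)
Lemma path4_rank (H : sgraph) (t : path_graph 4 -> int) (c : H -> path_graph 4) lam
    (x := fun i => quotient_diag lam (t (inord i))) :
  (forall i, t i != 0) -> blowup t c -> lam * (lam + 1) = 0 ->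
  (1 - x 0%N * x 1%N) * (1 - x 2%N * x 3%N) = x 0%N * x 3%N ->
  (walk_rank H <= 3)%N.
Proof.
move=> t0 Htc lam01 det0.
(* Starting from 1, the first three rows determine the kernel vector; the last row is the
   determinant equation. *)
pose ws := [:: 1; - x 0%N; x 0%N * x 1%N - 1; x 0%N + x 2%N * (1 - x 0%N * x 1%N)].
pose w (i : path_graph 4) : rat := ws`_i.
have tE (i : 'I_4) : quotient_diag lam (t i) = x i by rewrite /x inord_val.
have ker j : \sum_i (adj j i)%:R * w i + quotient_diag lam (t j) * w j = 0.
  rewrite tE /w /ws /=; rewrite !big_ord_recl big_ord0 /= /path_adj.
  by case: j => [[|[|[|[|j]]]] lt] //=; rewrite /bump /= ?mul0r ?mul1r; try lra; ring: det0.
(* The leading entry 1 expresses row 0 through rows 1, 2, 3. *)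
pose r (i : 'I_3) : path_graph 4 := lift ord0 i.
apply: (blowup_rank_span (t0 := t0) (Htc := Htc) (r := r)
  (a := fun j i => if j == ord0 :> 'I_4 then - w (r i) else (j == r i)%:R)) => j z.
have [->|j0] := eqVneq (j : 'I_4) ord0.
  have := walk_dependency t0 Htc z lam01 ker; rewrite big_ord_recl.
  rewrite [w ord0]/= mul1r => /eqP; rewrite addr_eq0 => /eqP ->.
  by rewrite -sumrN; apply: eq_bigr => i _; rewrite mulNr.
case: (unliftP ord0 j) j0 => [i ->|->]; last by rewrite eqxx.
move=> _; rewrite (bigD1 i) //= eqxx mul1r big1 ?addr0 // => k ki.
rewrite (inj_eq lift_inj) eq_sym (negPf ki) mul0r //.
Qed.

(** The quotient matrix has both eigenvalues 0 and -1; the two relations leave at most three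
    independent rows among five. *)
Lemma path5_rank (H : sgraph) (t : path_graph 5 -> int) (c : H -> path_graph 5)
    (x := fun lam i => quotient_diag lam (t (inord i))) :
  (forall i, t i != 0) -> blowup t c ->
  [/\ x 0 0%N = 0, x 0 2%N = 0 & x 0 4%N = 0] ->
  [/\ x (-1) 0%N = 1, x (-1) 1%N = 1, x (-1) 3%N = 1 & x (-1) 4%N = 1] ->
  (walk_rank H <= 3)%N.
Proof.
move=> t0 Htc [x00 x02 x04] [x10 x11 x13 x14].
have tE lam (i : 'I_5) : quotient_diag lam (t i) = x lam i by rewrite /x inord_val.
have dep lam (ws : seq rat) z : lam * (lam + 1) = 0 ->
    [/\ ws`_1 + x lam 0%N * ws`_0 = 0, ws`_0 + ws`_2 + x lam 1%N * ws`_1 = 0,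
        ws`_1 + ws`_3 + x lam 2%N * ws`_2 = 0, ws`_2 + ws`_4 + x lam 3%N * ws`_3 = 0
      & ws`_3 + x lam 4%N * ws`_4 = 0] ->
    \sum_(i < 5) ws`_i * walk (rep t0 Htc i) z = 0.
  move=> lam01 [e0 e1 e2 e3 e4].
  apply: (walk_dependency t0 Htc (w := fun i : path_graph 5 => ws`_i) z lam01) => j.
  rewrite tE !big_ord_recl big_ord0 /= /path_adj.
  by case: j => [[|[|[|[|[|j]]]]] lt] //=; rewrite /bump /= ?mul0r ?mul1r; lra.
have dep0 z := dep 0 [:: -1; 0; 1; 0; -1] z (mul0r _).
have dep1 z := dep (-1) [:: -1; 1; 0; -1; 1] z.
pose r (i : 'I_3) : path_graph 5 := inord (nth 0 [:: 0; 3; 4] i)%N.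
(* Coordinates of the five rows in terms of rows 0, 3 and 4, solved from the two relations. *)
pose a : seq (seq rat) :=
  [:: [:: 1; 0; 0]; [:: 1; 1; -1]; [:: 1; 0; 1]; [:: 0; 1; 0]; [:: 0; 0; 1]].
apply: (blowup_rank_span (t0 := t0) (Htc := Htc) (r := r)
  (a := fun j i => (nth [::] a (j : 'I_5))`_i)) => j z.
have {dep0} := dep0 z; have {dep1} := dep1 z.
rewrite !x00 !x02 !x04 x10 x11 x13 x14 /= !big_ord_recl !big_ord0 /= /bump /=.
pose W k := walk (rep t0 Htc (inord k)) z.
have WE (i : 'I_5) : walk (rep t0 Htc i) z = W (val i) by rewrite /W inord_val.
rewrite !WE /= /bump /= !inordK //= => dep1 dep0.
have {}dep0 : - W 0%N + W 2%N - W 4%N = 0.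
  by rewrite -[RHS]dep0; [ring | split; ring].
have {}dep1 : - W 0%N + W 1%N - W 3%N + W 4%N = 0.
  by rewrite -[RHS]dep1; [ring | ring | split; ring].
by case: j => [[|[|[|[|[|j]]]]] lt] //=; lra.
Qed.

(** Some nonzero combination [y] of the four class indicators is killed by [A (A + 1)]. Either
    [(A + 1) y] is an eigenvector for 0, or it vanishes and [y] is one for -1; both are constant on
    classes. *)
Lemma path4_det (H : sgraph) (t : path_graph 4 -> int) (c : H -> path_graph 4)
    (x := fun lam i => quotient_diag lam (t (inord i))) :
  (forall i, t i != 0) -> blowup t c ->
  (walk_rank H <= 3)%N ->
  exists2 lam, lam \in [:: 0; -1] &
    (1 - x lam 0%N * x lam 1%N) * (1 - x lam 2%N * x lam 3%N) = x lam 0%N * x lam 3%N.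
Proof.
move=> t0 Htc rk.
have n0 i : (`|t i|%N)%:R != 0 :> rat by rewrite pnatr_eq0 absz_eq0.
have tE lam (i : 'I_4) : quotient_diag lam (t i) = x lam i by rewrite /x inord_val.
(* By forward substitution, the entries of a kernel vector are multiples of the first one, which
   therefore is nonzero. *)
have eigen lam (w : 'I_4 -> rat) : (exists i, w i != 0) ->
    (forall u, nbr_sum (spread t c w) u = lam * spread t c w u) ->
    (1 - x lam 0%N * x lam 1%N) * (1 - x lam 2%N * x lam 3%N) = x lam 0%N * x lam 3%N.
  move=> w0 eig.
  have ker (j : 'I_4) : \sum_i (path_adj j i)%:R * w i + x lam j * w j = 0.
    rewrite -tE; have := nbr_sum_spread t0 Htc lam w (rep t0 Htc j).
    by rewrite eig subrr repK.
  have inj0 (i : 'I_4) : w i = w (inord i) by rewrite inord_val.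
  have := ker (inord 0); have := ker (inord 1); have := ker (inord 2); have := ker (inord 3).
  rewrite !big_ord_recl !big_ord0 /path_adj !inordK //= /bump /= !mul0r !mul1r !addr0 !add0r.
  rewrite (inj0 ord0) !(inj0 (lift _ _)) /= /bump /=.
  set a := w (inord 0); set b := w (inord 1); set d := w (inord 2); set e := w (inord 3).
  move: (x lam 0%N) (x lam 1%N) (x lam 2%N) (x lam 3%N) => x0 x1 x2 x3 e3 e2 e1 e0.
  have bE : b = - (x0 * a) by lra.
  have dE : d = - a + x1 * x0 * a by have := e1; rewrite bE; lra.
  have eE : e = x0 * a - x2 * d by have := e2; rewrite bE; lra.
  have : ((1 - x0 * x1) * (1 - x2 * x3) - x0 * x3) * a = 0.
    by apply/eqP; rewrite -oppr_eq0; apply/eqP; rewrite -[RHS]e3 eE dE; ring.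
  move/eqP; rewrite mulf_eq0 subr_eq0 => /orP [/eqP //|/eqP a0].
  have b0 : b = 0 by rewrite bE a0; ring.
  have d0 : d = 0 by rewrite dE a0; ring.
  have e00 : e = 0 by rewrite eE a0 d0; ring.
  case: w0 => i; rewrite inj0.
  by case: i => [[|[|[|[|i]]]] lt] //=; rewrite -/a -/b -/d -/e ?a0 ?b0 ?d0 ?e00 eqxx.
have [w [i wi] ker] := rank_ltP (fun (i : 'I_4) u => (c u == i :> 'I_4)%:R) rk.
(* Rescaling compensates for the division in [spread]. *)
pose w' j := (`|t j|%N)%:R * w j.
have w'E u : \sum_i w i * (c u == i :> 'I_4)%:R = spread t c w' u.
  rewrite (bigD1 (c u)) //= eqxx mulr1 big1 ?addr0; last first.
    by move=> j; rewrite eq_sym => /negPf ->; rewrite mulr0.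
  by rewrite /spread /w'; field; apply: n0.
have w'0 : exists i, w' i != 0 by exists i; rewrite mulf_neq0.
pose z j := \sum_k (path_adj j k)%:R * w' k + quotient_diag (-1) (t j) * w' j.
pose z' j := (`|t j|%N)%:R * z j.
have zE u : nbr_sum (spread t c w') u + spread t c w' u = spread t c z' u.
  have := nbr_sum_spread t0 Htc (-1) w' u; rewrite mulN1r opprK => ->.
  by rewrite [RHS]/spread /z' [RHS]mulrAC divff ?mul1r // n0.
have kerz u : nbr_sum (spread t c z') u = 0.
  rewrite -[RHS](ker u) /shift_sum /nbr_sum; apply: eq_bigr => v _; congr (_ * _).
  by rewrite -zE /nbr_sum w'E; congr (_ + _); apply: eq_bigr => v' _; rewrite w'E.
have [/existsP z0|/existsPn z0] := boolP [exists i, z' i != 0].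
  by exists 0 => //; apply: eigen z0 _ => u; rewrite kerz mul0r.
exists (-1) => //; apply: eigen w'0 _ => u.
apply/eqP; rewrite mulN1r -addr_eq0 zE /spread.
by move/(_ (c u)): z0 => /negPn /eqP ->; rewrite mul0r.
Qed.

(** * The paths P4 and P5 *)

(** The equation is [(a b - 1) (d e - 1) = b d]. If [a] and [e] are at least 2, the left side is at
    least [(2 b - 1) (2 d - 1)], which forces [b = d = 1]; the cases [a = 1] and [e = 1] are mirror
    images. *)
Lemma minus_one_solutions (a b d e : nat) :
  (0 < a)%N -> (0 < b)%N -> (0 < d)%N -> (0 < e)%N ->
  (b * d + a * b + d * e = a * b * (d * e) + 1)%N ->
  (a, b, d, e) \in [:: (1, 3, 2, 2); (1, 2, 1, 3); (2, 1, 1, 2);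
                       (2, 2, 3, 1); (3, 1, 2, 1)]%N.
Proof.
have one (x y z : nat) : (0 < x)%N -> (0 < y)%N -> (0 < z)%N ->
    (x * y + x + y * z = x * (y * z) + 1)%N ->
    [/\ x = 3, y = 2 & z = 2]%N \/ [/\ x = 2, y = 1 & z = 3]%N.
  case: x => [//|x]; case: y => [//|y]; case: z => [//|z] _ _ _ eqn.
  have z0 : (0 < z)%N by case: z eqn => //; lia.
  have x0 : (0 < x)%N by case: x eqn => //; lia.
  have {}eqn : (x * (y * z + z - 1) = y.+1)%N by nia.
  case: z z0 eqn => [//|[|z]] _ eqn.
    have {}eqn : (x * y = y.+1)%N by nia.
    case: y eqn => [|[|y]]; [lia|left; split; lia|move=> eqn; exfalso].
    by case: x {x0} eqn => [|[|x]]; nia.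
  have y0 : y = 0%N by case: y eqn => // y; nia.
  by right; rewrite y0 in eqn *; case: z eqn => [|z]; [split; lia|nia].
move=> a0 b0 d0 e0 eqn.
case: (leqP a 1) => a1.
  have aE : a = 1%N by lia.
  case: (one b d e b0 d0 e0) => [|[-> -> ->]|[-> -> ->]]; [nia | by rewrite aE | by rewrite aE].
case: (leqP e 1) => e1.
  have eE : e = 1%N by lia.
  case: (one d b a d0 b0 a0) => [|[-> -> ->]|[-> -> ->]]; [nia | by rewrite eE | by rewrite eE].
have eqn' : ((a * b - 1) * (d * e - 1) = b * d)%N by nia.
have ab : (2 * b - 1 <= a * b - 1)%N by nia.
have de : (2 * d - 1 <= d * e - 1)%N by nia.
have := leq_mul ab de; rewrite eqn' => bd.
have [b1 d1] : b = 1%N /\ d = 1%N.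
  by move: b0 d0 bd; case: (b) => // b'; case: (d) => // d' _ _; clear; split; nia.
rewrite b1 d1 in eqn *.
have [-> ->] : (a = 2 /\ e = 2)%N by nia.
by [].
Qed.

(** The equation is [1/x + 1/y + 1/z = 1]: either some denominator is 2 and the other two
    reciprocals sum to 1/2, or all are 3. *)
Lemma zero_solutions_egyptian (x y z : nat) :
  (0 < x)%N -> (0 < y)%N -> (0 < z)%N ->
  (x * y * z = x * y + y * z + z * x)%N ->
  (x.+1, y, z) \in [:: (3, 3, 6); (3, 4, 4); (3, 6, 3); (4, 2, 6); (4, 3, 3);
                       (4, 6, 2); (5, 2, 4); (5, 4, 2); (7, 2, 3); (7, 3, 2)]%N.
Proof.
have two (y' z' : nat) : (2 * (y' * z') = 2 * y' + y' * z' + 2 * z')%N ->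
    (0 < y')%N -> (0 < z')%N -> (y', z') \in [:: (3, 6); (4, 4); (6, 3)]%N.
  move=> eqn y0 z0.
  have y_gt2 : (2 < y')%N by nia.
  have z_gt2 : (2 < z')%N by nia.
  have y_le : (y' <= 6)%N by nia.
  have : y' \in [:: 3; 4; 5; 6]%N by rewrite !inE; lia.
  rewrite !inE => /or4P [] /eqP yE; rewrite yE in eqn *; rewrite !xpair_eqE; lia.
move=> x0 y0 z0 eqn.
have x1 : (1 < x)%N by nia.
have y1 : (1 < y)%N by nia.
have z1 : (1 < z)%N by nia.
case: (x =P 2%N) => [xE|x2].
  rewrite xE in eqn *; have : (y, z) \in [:: (3, 6); (4, 4); (6, 3)]%N by apply: two; nia.
  by rewrite !inE => /or3P [] /eqP [-> ->].
case: (y =P 2%N) => [yE|y2].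
  rewrite yE in eqn *; have : (x, z) \in [:: (3, 6); (4, 4); (6, 3)]%N by apply: two; nia.
  by rewrite !inE => /or3P [] /eqP [-> ->].
case: (z =P 2%N) => [zE|z2].
  rewrite zE in eqn *; have : (x, y) \in [:: (3, 6); (4, 4); (6, 3)]%N by apply: two; nia.
  by rewrite !inE => /or3P [] /eqP [-> ->].
have x3 : (2 < x)%N by lia.
have y3 : (2 < y)%N by lia.
have z3 : (2 < z)%N by lia.
(* Each of the three products is at most a third of [x y z], and they sum to it, so all bounds are
   tight. *)
have hz : (x * y * 3 <= x * y * z)%N by rewrite leq_mul2l z3 orbT.
have hx : (y * z * 3 <= y * z * x)%N by rewrite leq_mul2l x3 orbT.
have hy : (z * x * 3 <= z * x * y)%N by rewrite leq_mul2l y3 orbT.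
have sum_eq : ((x * y * 3 == x * y * z) && (y * z * 3 == y * z * x) &&
               (z * x * 3 == z * x * y))%N by lia.
move: sum_eq; rewrite !eqn_mul2l !muln_eq0 => h.
have [-> -> ->] : [/\ x = 3, y = 3 & z = 3]%N by split; lia.
by [].
Qed.

Definition clique_types : seq (nat * nat * nat * nat) :=
  [:: (2, 2, 2, 7); (2, 2, 3, 4); (2, 2, 6, 3); (2, 3, 2, 5); (2, 3, 4, 3);
      (2, 5, 2, 4); (2, 5, 3, 3); (3, 2, 2, 3)]%N.

(** The equation is [(1/x + 1/y) (1/z + 1/u) = 1], so one factor is at least 1; by symmetry it is
    the first. Then [x = y = 2], or [x = 1] and the second factor is at least 2/3, which bounds [z]
    and [u] by 6. *)
Lemma zero_solutions_cliques (x y z u : nat) :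
  (0 < x)%N -> (1 < y)%N -> (1 < z)%N -> (0 < u)%N ->
  ((x + y) * (z + u) = x * y * (z * u))%N ->
  (x.+1, y, z, u.+1) \in clique_types \/ (u.+1, z, y, x.+1) \in clique_types.
Proof.
have half (a b d e : nat) : (0 < a)%N -> (1 < b)%N -> (1 < d)%N -> (0 < e)%N ->
    ((a + b) * (d + e) = a * b * (d * e))%N -> (a * b <= a + b)%N ->
    (a.+1, b, d, e.+1) \in clique_types.
  move=> a0 b1 d1 e0 eqn ab; case: (leqP a 1) => a1; last first.
    have [aE bE] : a = 2%N /\ b = 2%N by split; nia.
    rewrite aE bE in eqn *.
    have : (d.-1 * e.-1 = 1)%N.
      by move: d1 e0 eqn; case: (d) => // d'; case: (e) => // e'; rewrite /=; lia.
    move/eqP; rewrite muln_eq1 => /andP [/eqP dE /eqP eE].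
    by have [-> ->] : d = 2%N /\ e = 2%N by split; lia.
  have aE : a = 1%N by lia.
  rewrite aE mul1n in eqn *.
  have e1 : (1 < e)%N.
    rewrite ltnNge; apply/negP => e1; have eE : e = 1%N by lia.
    rewrite eE muln1 in eqn; clear -eqn b1; nia.
  have bd : (2 * (d * e) <= 3 * (d + e))%N by nia.
  have d_le : (d <= 6)%N by nia.
  have e_le : (e <= 6)%N by nia.
  have : d \in [:: 2; 3; 4; 5; 6]%N by rewrite !inE; lia.
  have : e \in [:: 2; 3; 4; 5; 6]%N by rewrite !inE; lia.
  clear -eqn b1; rewrite !inE !xpair_eqE /=.
  by do ![case/orP | move=> /eqP dE; subst]; lia.
move=> x0 y1 z1 u0 eqn.
case: (leqP (x * y) (x + y)) => xy; first by left; apply: half.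
right; apply: half => //; first by rewrite mulnC addnC [(u + z)%N]addnC eqn; lia.
rewrite leqNgt; apply/negP => zu.
by have := ltn_mul xy zu; rewrite [(u + z)%N]addnC eqn [(u * z)%N]mulnC ltnn.
Qed.

(** * Quotient determinants in terms of class sizes *)

Lemma quotient_diag_gt0 lam z : 0 < z -> quotient_diag lam z = (z%:~R - 1 - lam) / z%:~R.
Proof. by move=> z0; rewrite /quotient_diag z0 natr_absz gtr0_norm. Qed.

Lemma quotient_diag_lt0 lam z : z < 0 -> quotient_diag lam z = lam / z%:~R.
Proof.
move=> z0; rewrite /quotient_diag ltNge (ltW z0) /= natr_absz ltr0_norm //.
by rewrite sub0r rmorphN invrN mulrNN.
Qed.

Lemma path_resign n (H : sgraph) (t t' : n.-tuple int) :
  (forall i, `|tnth t' i|%N = `|tnth t i|%N) ->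
  (forall i, (1 < `|tnth t i|)%N -> (0 < tnth t' i) = (0 < tnth t i)) ->
  is_path_mixed_extension H t -> is_path_mixed_extension H t'.
Proof.
move=> tt' sgn /mixed_blowup [t0 [c Htc]].
apply: (blowup_mixed (c := c)); last exact: blowup_resign Htc.
by move=> i; rewrite -absz_eq0 tt' absz_eq0.
Qed.

Lemma path4_mirror (H : sgraph) (a b d e : int) :
  is_path_mixed_extension H [tuple a; b; d; e] ->
  is_path_mixed_extension H [tuple e; d; b; a].
Proof.
case/mixed_blowup=> t0 [c [sz adjE]].
have tE (i : 'I_4) : tnth [tuple e; d; b; a] i = tnth [tuple a; b; d; e] (rev_ord i).
  by rewrite !(tnth_nth 0); case: i => [[|[|[|[|i]]]] lt].
have revE (i j : 'I_4) : path_adj (rev_ord i) (rev_ord j) = path_adj i j.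
  by case: i j => i i4 [j j4]; rewrite /path_adj /=; lia.
apply: (@blowup_mixed H (path_graph 4) _ (fun x => rev_ord (c x))) => [i|]; first by rewrite tE t0.
split=> [i|x y].
  rewrite tE -sz; apply: eq_card => x; rewrite !inE.
  by rewrite -(inj_eq rev_ord_inj) rev_ordK.
by rewrite adjE (inj_eq rev_ord_inj) tE rev_ordK /= revE.
Qed.

(** For the eigenvalue -1 a clique of any size acts like a single vertex; for the eigenvalue 0 a
    coclique does. *)
Definition coclique_size (z : int) : nat := if 0 < z then 1 else `|z|%N.
Definition clique_size (z : int) : nat := if 0 < z then `|z|%N else 1.

Lemma quotient_diag0 z : z != 0 -> quotient_diag 0 z = 1 - (clique_size z)%:R^-1.
Proof.
move=> z0; rewrite /clique_size; case: (ltrgt0P z) z0 => // z0 _.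
  by rewrite quotient_diag_gt0 // natr_absz gtr0_norm //; field; rewrite intr_eq0; lia.
by rewrite quotient_diag_lt0 // mul0r invr1 subrr.
Qed.

Lemma quotient_diagN1 z : z != 0 -> quotient_diag (-1) z = (coclique_size z)%:R^-1.
Proof.
move=> z0; rewrite /coclique_size; case: (ltrgt0P z) z0 => // z0 _.
  by rewrite quotient_diag_gt0 // invr1; field; rewrite intr_eq0; lia.
by rewrite quotient_diag_lt0 // natr_absz ltr0_norm // rmorphN invrN mulN1r.
Qed.

Lemma det_minus_one (a b d e : nat) :
  (0 < a)%N -> (0 < b)%N -> (0 < d)%N -> (0 < e)%N ->
  (1 - a%:R^-1 * b%:R^-1) * (1 - d%:R^-1 * e%:R^-1) = a%:R^-1 * e%:R^-1 :> rat ->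
  (b * d + a * b + d * e = a * b * (d * e) + 1)%N.
Proof.
rewrite !lt0n -!(pnatr_eq0 rat) => a0 b0 d0 e0 det.
apply/eqP; rewrite -(eqr_nat rat) !(natrD, natrM); apply/eqP.
have := congr1 (fun x => x * (a%:R * b%:R * d%:R * e%:R)) det => /=.
have -> : (1 - a%:R^-1 * b%:R^-1) * (1 - d%:R^-1 * e%:R^-1) *
   (a%:R * b%:R * d%:R * e%:R) =
   (a%:R * b%:R - 1) * (d%:R * e%:R - 1) :> rat by field; rewrite ?a0 ?b0 ?d0 ?e0.
have -> : a%:R^-1 * e%:R^-1 * (a%:R * b%:R * d%:R * e%:R) = b%:R * d%:R :> rat.
  by field; rewrite ?a0 ?e0.
by move=> <-; ring.
Qed.

(** With [a.+1] and [b] the sizes at one end, [1 - x0 x1] is [(a + b) / ((a + 1) b)]; shifting the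
    end sizes cancels the remaining denominators. *)
Lemma det_zero (a b d e : nat) : (0 < b)%N -> (0 < d)%N ->
  (1 - (1 - a.+1%:R^-1) * (1 - b%:R^-1)) * (1 - (1 - d%:R^-1) * (1 - e.+1%:R^-1)) =
    (1 - a.+1%:R^-1) * (1 - e.+1%:R^-1) :> rat ->
  ((a + b) * (d + e) = a * b * (d * e))%N.
Proof.
have := ltn0Sn a; have := ltn0Sn e.
rewrite !lt0n -!(pnatr_eq0 rat) -(addn1 a) -(addn1 e) !natrD => e0 a0 b0 d0 det.
apply/eqP; rewrite -(eqr_nat rat) !(natrD, natrM); apply/eqP.
have := congr1 (fun x => x * ((a%:R + 1) * b%:R * d%:R * (e%:R + 1))) det => /=.
have -> : (1 - (1 - (a%:R + 1)^-1) * (1 - b%:R^-1)) *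
   (1 - (1 - d%:R^-1) * (1 - (e%:R + 1)^-1)) *
   ((a%:R + 1) * b%:R * d%:R * (e%:R + 1)) =
   (a%:R + b%:R) * (d%:R + e%:R) :> rat by field; rewrite ?a0 ?b0 ?d0 ?e0.
by move=> ->; field; rewrite ?a0 ?e0.
Qed.

(** * The four families and the mixed extensions of P4 *)

Definition type_a (H : sgraph) : Prop := exists p q r : int,
      [/\ 1 <= p, 1 <= q & 1 <= r] /\
      [\/ is_path_mixed_extension H [tuple p; -3; -2; -2],
          is_path_mixed_extension H [tuple -2; q; r; -2]
        | is_path_mixed_extension H [tuple p; -2; r; -3]].

Definition type_b (H : sgraph) : Prop := exists p q r s : int,
      [/\ 1 <= r,
          (p, q, s) \in [:: (3, 3, 6); (3, 4, 4); (3, 6, 3); (4, 2, 6);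
                            (4, 3, 3); (4, 6, 2); (5, 2, 4); (5, 4, 2);
                            (7, 2, 3); (7, 3, 2)]
        & is_path_mixed_extension H [tuple p; q; - r; s]].

Definition type_c (H : sgraph) : Prop := exists p q r s : int,
      (p, q, r, s) \in [:: (2, 2, 2, 7); (2, 2, 3, 4); (2, 2, 6, 3);
                           (2, 3, 2, 5); (2, 3, 4, 3); (2, 5, 2, 4);
                           (2, 5, 3, 3); (3, 2, 2, 3)] /\
      is_path_mixed_extension H [tuple p; q; r; s].

Definition type_d (H : sgraph) : Prop := exists p q r : int,
      [/\ 1 <= p, 1 <= q & 1 <= r] /\
      is_path_mixed_extension H [tuple 1; p; - q; r; 1].

Lemma coclique_size1 z : z != 0 -> z != -1 -> coclique_size z = 1%N -> 1 <= z.
Proof. by rewrite /coclique_size; case: ltrP => h; lia. Qed.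

Lemma coclique_size_gt1 z n : coclique_size z = n.+2 -> z = - (n.+2)%:Z.
Proof. by rewrite /coclique_size; case: ltrP => h; lia. Qed.

Lemma clique_size1 z : clique_size z = 1%N -> z <= 1.
Proof. by rewrite /clique_size; case: ltrP => h; lia. Qed.

Lemma clique_size_gt1 z n : clique_size z = n.+2 -> z = n.+2.
Proof. by rewrite /clique_size; case: ltrP => h; lia. Qed.

Lemma path4_minus_one (H : sgraph) (a b d e : int) :
  [/\ a != 0, b != 0, d != 0 & e != 0] ->
  [/\ a != -1, b != -1, d != -1 & e != -1] ->
  is_path_mixed_extension H [tuple a; b; d; e] ->
  (coclique_size a, coclique_size b, coclique_size d, coclique_size e)
    \in [:: (1, 3, 2, 2); (1, 2, 1, 3); (2, 1, 1, 2); (2, 2, 3, 1); (3, 1, 2, 1)]%N ->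
  type_a H.
Proof.
move=> [a0 b0 d0 e0] [a1 b1 d1 e1] Ht.
rewrite !inE => /or4P [||| /orP []] /eqP [] .
- move=> /(coclique_size1 a0 a1) ap /coclique_size_gt1 bE
    /coclique_size_gt1 dE /coclique_size_gt1 eE.
  by exists a, 1, 1; split=> //; apply: Or31; rewrite bE dE eE in Ht.
- move=> /(coclique_size1 a0 a1) ap /coclique_size_gt1 bE
    /(coclique_size1 d0 d1) dp /coclique_size_gt1 eE.
  by exists a, 1, d; split=> //; apply: Or33; rewrite bE eE in Ht.
- move=> /coclique_size_gt1 aE /(coclique_size1 b0 b1) bp
    /(coclique_size1 d0 d1) dp /coclique_size_gt1 eE.
  by exists 1, b, d; split=> //; apply: Or32; rewrite aE eE in Ht.
- move=> /coclique_size_gt1 aE /coclique_size_gt1 bE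
    /coclique_size_gt1 dE /(coclique_size1 e0 e1) ep.
  by exists e, 1, 1; split=> //; apply/Or31/path4_mirror; rewrite aE bE dE in Ht.
move=> /coclique_size_gt1 aE /(coclique_size1 b0 b1) bp
    /coclique_size_gt1 dE /(coclique_size1 e0 e1) ep.
by exists e, 1, b; split=> //; apply/Or33/path4_mirror; rewrite aE dE in Ht.
Qed.

Lemma path4_egyptian (H : sgraph) (a b d e : int) :
  d != 0 -> is_path_mixed_extension H [tuple a; b; d; e] ->
  clique_size d = 1%N ->
  (clique_size a, clique_size b, clique_size e)
    \in [:: (3, 3, 6); (3, 4, 4); (3, 6, 3); (4, 2, 6); (4, 3, 3);
            (4, 6, 2); (5, 2, 4); (5, 4, 2); (7, 2, 3); (7, 3, 2)]%N ->
  type_b H.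
Proof.
(* [d] is negative or 1; in the latter case it is replaced by -1. *)
move=> d0 Ht /clique_size1 d1 abe; exists a, b, `|d|%N%:Z, e; split; first by lia.
  move: abe; rewrite !inE.
  do ![case/orP]; move=> /eqP [] /clique_size_gt1 -> /clique_size_gt1 -> /clique_size_gt1 -> //.
apply: path_resign Ht => i; rewrite !(tnth_nth 0); case: i => [[|[|[|[|i]]]] lt] //=; lia.
Qed.

Lemma path4_cliques (H : sgraph) (a b d e : int) :
  is_path_mixed_extension H [tuple a; b; d; e] ->
  (clique_size a, clique_size b, clique_size d, clique_size e) \in clique_types ->
  type_c H.
Proof.
move=> Ht abde; exists a, b, d, e; split=> //; move: abde; rewrite !inE.
do ![case/orP]; move=> /eqP [] /clique_size_gt1 -> /clique_size_gt1 ->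
  /clique_size_gt1 -> /clique_size_gt1 -> //.
Qed.

(** Eigenvalue -1 leads to (a). Eigenvalue 0 leads to (b) if an inner class acts like a single
    vertex, and to (c) otherwise. *)
Lemma path4_types (H : sgraph) (a b d e : int) :
  [/\ a != -1, b != -1, d != -1 & e != -1] ->
  is_path_mixed_extension H [tuple a; b; d; e] ->
  (walk_rank H <= 3)%N ->
  [\/ type_a H, type_b H | type_c H].
Proof.
move=> abde1 Ht rk; have [t0 [c Htc]] := mixed_blowup Ht.
have a0 : a != 0 by have := t0 (inord 0); rewrite (tnth_nth 0) inordK.
have b0 : b != 0 by have := t0 (inord 1); rewrite (tnth_nth 0) inordK.
have d0 : d != 0 by have := t0 (inord 2); rewrite (tnth_nth 0) inordK.
have e0 : e != 0 by have := t0 (inord 3); rewrite (tnth_nth 0) inordK.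
have [lam] := path4_det t0 Htc rk.
rewrite !(tnth_nth 0) !inordK //= !inE => /orP [] /eqP ->; last first.
  rewrite !quotient_diagN1 // => /det_minus_one eqn; apply: Or31.
  apply: (path4_minus_one (And4 a0 b0 d0 e0) abde1 Ht).
  by apply: minus_one_solutions (eqn _ _ _ _); rewrite /coclique_size; case: ifP => //; lia.
have pos z : z != 0 -> exists n, clique_size z = n.+1.
  by move=> z0; exists (clique_size z).-1; rewrite prednK // /clique_size; case: ifP => //; lia.
have [x xE] := pos a a0; have [y yE] := pos b b0; have [z zE] := pos d d0; have [u uE] := pos e e0.
rewrite !quotient_diag0 // xE yE zE uE => /det_zero -/(_ isT isT) eqn.
(* Were an end class to act like a single vertex, the right side of [eqn] would vanish but not the
   left. *)
have x_gt0 : (0 < x)%N by case: x {xE} eqn => //; lia.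
have u_gt0 : (0 < u)%N by case: u {uE} eqn => //; lia.
case: (posnP z) => [z0|z_gt0].
  rewrite z0 in zE eqn; apply/Or32/(path4_egyptian d0 Ht zE).
  by rewrite xE yE uE; apply: zero_solutions_egyptian => //; lia.
case: (posnP y) => [y0|y_gt0].
  rewrite y0 in yE eqn; apply/Or32/(path4_egyptian b0 (path4_mirror Ht) yE).
  by rewrite xE zE uE; apply: zero_solutions_egyptian => //; lia.
have [//| |h|h] := zero_solutions_cliques x_gt0 _ _ u_gt0 eqn; first by [].
- by apply/Or33/(path4_cliques Ht); rewrite xE yE zE uE.
by apply/Or33/(path4_cliques (path4_mirror Ht)); rewrite xE yE zE uE.
Qed.

(** * From templates to mixed extensions *)

Definition signed_size (H : sgraph) (T : seq (seq nat) * seq nat)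
    (c : H -> nat) (i : nat) : int :=
  if row_adj T.1 i i then (cell_size [set: H] c i)%:Z
  else - (cell_size [set: H] c i)%:Z.

Lemma abs_signed_size (H : sgraph) T (c : H -> nat) i :
  `|signed_size T c i|%N = cell_size [set: H] c i.
Proof. by rewrite /signed_size; case: ifP => _; rewrite ?abszN absz_nat. Qed.

Lemma classified_mixed (H : sgraph) T (c : H -> nat) n (e : rel 'I_n)
    (e_sym : symmetric e) (e_irr : irreflexive e) (t : 'I_n -> int) :
  classified T [set: H] c -> size T.1 = n ->
  (forall i j : 'I_n, i != j -> e i j = row_adj T.1 i j) ->
  (forall i : 'I_n, t i = signed_size T c i) ->
  @is_mixed_extension_of_type H (SGraph e_sym e_irr) t.
Proof.
case=> c_lt c_onto adjE _ _ szT eE tE.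
have lt x : (c x < n)%N by rewrite -szT c_lt.
have size_gt0 (i : 'I_n) : (0 < cell_size [set: H] c i)%N by rewrite c_onto ?szT.
apply: (@blowup_mixed H (SGraph e_sym e_irr) t (fun x => Ordinal (lt x))) => [i|].
  by rewrite -absz_gt0 tE abs_signed_size.
split=> [i|x y].
  by rewrite tE abs_signed_size; apply: eq_card => x; rewrite !inE -val_eqE.
have [-> | xy] := eqVneq x y; first by rewrite eqxx andbF adj_irr.
rewrite adjE ?inE // -val_eqE /=; case: eqVneq => cxy /=.
  rewrite tE andbT -cxy /signed_size; have := size_gt0 (Ordinal (lt x)) => /=.
  by case: row_adj; lia.
by rewrite eE // -val_eqE.
Qed.

Definition is_path_rows (r : seq (seq nat)) :=
  all (fun i => all (fun j => (i == j) ||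
    (row_adj r i j == (i.+1 == j) || (j.+1 == i))) (iota 0 (size r))) (iota 0 (size r)).

(** A computable form of connectedness for graphs on at most three vertices. *)
Definition has_diameter2 (r : seq (seq nat)) :=
  let V := iota 0 (size r) in
  all (fun i => all (fun j => [|| i == j, row_adj r i j |
    has (fun k => row_adj r i k && row_adj r k j && (i != k) && (k != j)) V]) V) V.

Lemma template_cases : all (fun T =>
  [|| (0 < size T.1 <= 3)%N && has_diameter2 T.1,
      (size T.1 == 4) && is_path_rows T.1 |
      [&& size T.1 == 5, is_path_rows T.1, (0 \in T.2), (4 \in T.2),
          row_adj T.1 0 0, row_adj T.1 1 1, (2 \in T.2) || ~~ row_adj T.1 2 2,
          row_adj T.1 3 3 & row_adj T.1 4 4]]%N) templates.
Proof. by vm_compute. Qed.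

Lemma row_adj_sym r : symmetric (row_adj r).
Proof. by move=> i j; rewrite /row_adj orbC. Qed.

Section RowGraph.
Variable r : seq (seq nat).

Definition row_graph_adj : rel 'I_(size r) := fun i j => (i != j) && row_adj r i j.

Lemma row_graph_adj_sym : symmetric row_graph_adj.
Proof. by move=> i j; rewrite /row_graph_adj eq_sym row_adj_sym. Qed.

Lemma row_graph_adj_irr : irreflexive row_graph_adj.
Proof. by move=> i; rewrite /row_graph_adj eqxx. Qed.

Definition row_graph := SGraph row_graph_adj_sym row_graph_adj_irr.

Lemma row_graph_connected : has_diameter2 r -> graph_connected row_graph.
Proof.
move=> diam i j; have := all_iota (all_iota diam (ltn_ord i)) (ltn_ord j).
case/or3P => [/eqP /val_inj -> | ij | /hasP [k]].
- exact: connect0.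
- have [->|ij'] := eqVneq i j; first exact: connect0.
  by apply: connect1; rewrite /= /row_graph_adj ij'.
rewrite mem_iota /= => k_lt /andP [/andP [/andP [ik kj] ik'] kj'].
have k_lt' : (k < size r)%N by [].
by apply: (connect_trans (y := Ordinal k_lt' : row_graph)); apply: connect1;
   rewrite /= /row_graph_adj -val_eqE /= ?ik ?kj ?ik' ?kj'.
Qed.

End RowGraph.

Lemma path_rows_adj r n (i j : 'I_n) : is_path_rows r -> size r = n -> i != j ->
  path_adj i j = row_adj r i j.
Proof.
move=> pr sz ij; have i_lt : (i < size r)%N by rewrite sz.
have j_lt : (j < size r)%N by rewrite sz.
by have := all_iota (all_iota pr i_lt) j_lt; rewrite val_eqE (negPf ij) /= => /eqP ->.
Qed.

Lemma classification (H : sgraph) :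
  (0 < #|H|)%N -> graph_connected H ->
  (walk_rank H <= 3)%N ->
  (exists G : sgraph,
      [/\ (0 < #|G| <= 3)%N, graph_connected G & is_mixed_extension H G])
  \/ [\/ type_a H, type_b H, type_c H | type_d H].
Proof.
move=> H0 conn rk; have [T T_in [c HT]] := connected_classified H0 conn rk.
have [_ c_onto _ c_coclique c_single] := HT.
case/or3P: (allP template_cases _ T_in).
- case/andP => szT diam; left; exists (row_graph T.1); split.
  + by rewrite card_ord.
  + exact: row_graph_connected.
  exists (fun i : 'I_(size T.1) => signed_size T c i); apply: classified_mixed HT _ _ _ => //.
  by move=> i j ij; rewrite /row_graph_adj ij.
- case/andP => /eqP szT pr; right.
  (* Singleton classes are cliques, hence have type 1. *)
  have notN1 i : (i < 4)%N -> signed_size T c i != -1.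
    rewrite -szT => i_lt; have := c_coclique i i_lt; have := c_onto i i_lt.
    by rewrite /signed_size; case: row_adj => /=; lia.
  have Ht : is_path_mixed_extension H [tuple signed_size T c 0; signed_size T c 1;
                                             signed_size T c 2; signed_size T c 3].
    apply: (classified_mixed _ _ HT szT) => [i j ij|i]; first exact: path_rows_adj.
    by rewrite (tnth_nth 0); case: i => [[|[|[|[|i]]]] lt].
  have := path4_types (And4 (notN1 0 isT) (notN1 1 isT) (notN1 2 isT) (notN1 3 isT))%N Ht rk.
  by case; [apply: Or41 | apply: Or42 | apply: Or43].
move=> /andP [/eqP szT /and4P [pr s0 s4 /and5P [r0 r1 r2 r3 r4]]]; right; apply: Or44.
have size_gt0 i : (i < 5)%N -> (0 < cell_size [set: H] c i)%N by rewrite -szT; apply: c_onto.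
exists (signed_size T c 1), (cell_size [set: H] c 2), (signed_size T c 3).
rewrite /signed_size r1 r3; split; first by split; rewrite lez_nat size_gt0.
have Ht : is_path_mixed_extension H [tuple signed_size T c 0; signed_size T c 1;
    signed_size T c 2; signed_size T c 3; signed_size T c 4].
  apply: (classified_mixed _ _ HT szT) => [i j ij|i]; first exact: path_rows_adj.
  by rewrite (tnth_nth 0); case: i => [[|[|[|[|[|i]]]]] lt].
(* A singleton middle class may carry the sign of a clique; it is changed to fit [- q]. *)
apply: path_resign Ht => i; rewrite !(tnth_nth 0) /signed_size;
  rewrite r0 r1 r3 r4 (c_single _ s0) (c_single _ s4).
  by case: i => [[|[|[|[|[|i]]]]] lt] //=; case: ifP; rewrite ?abszN.
case: i => [[|[|[|[|[|i]]]]] lt] //=.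
case/orP: r2 => [/c_single -> | /negPf ->]; first by case: row_adj.
by [].
Qed.

(** * The listed graphs have rank at most three *)

Definition singular4 (x : int -> rat) (a b d e : int) : bool :=
  (1 - x a * x b) * (1 - x d * x e) == x a * x e.

Lemma path4_type_rank (H : sgraph) lam (a b d e : int) :
  lam * (lam + 1) = 0 -> is_path_mixed_extension H [tuple a; b; d; e] ->
  singular4 (quotient_diag lam) a b d e ->
  (walk_rank H <= 3)%N.
Proof.
move=> lam01 /mixed_blowup [t0 [c Htc]] /eqP det.
by apply: (path4_rank t0 Htc lam01); rewrite !(tnth_nth 0) !inordK.
Qed.

Lemma quotient_diagN1_gt0 p : 1 <= p -> quotient_diag (-1) p = 1.
Proof.
move=> p1; rewrite quotient_diagN1; last by lia.
have -> : coclique_size p = 1%N by rewrite /coclique_size ifT //; lia.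
exact: invr1.
Qed.

(** At eigenvalue -1 every clique has diagonal entry 1, whatever its size, so the determinant is a
    fixed number. *)
Lemma type_a_rank (H : sgraph) : type_a H -> (walk_rank H <= 3)%N.
Proof.
have lam01 : (-1) * (-1 + 1) = 0 :> rat by [].
case=> p [q [r [[p1 q1 r1] Ht]]].
by case: Ht => Ht; apply: (path4_type_rank lam01 Ht);
   rewrite /singular4 ?(quotient_diagN1_gt0 p1) ?(quotient_diagN1_gt0 q1) ?(quotient_diagN1_gt0 r1).
Qed.

(** At eigenvalue 0 the coclique has diagonal entry 0, so [r] drops out and finitely many
    determinants remain. *)
Lemma type_b_rank (H : sgraph) : type_b H -> (walk_rank H <= 3)%N.
Proof.
have lam01 : 0 * (0 + 1) = 0 :> rat by [].
case=> p [q [r [s [r1 pqs Ht]]]]; apply: (path4_type_rank lam01 Ht).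
have r0 : quotient_diag 0 (- r) = 0 by rewrite quotient_diag_lt0 ?mul0r //; lia.
rewrite /singular4 r0; move: pqs; rewrite !inE.
by do ![case/orP]; move=> /eqP [-> -> ->].
Qed.

Lemma type_c_rank (H : sgraph) : type_c H -> (walk_rank H <= 3)%N.
Proof.
have lam01 : 0 * (0 + 1) = 0 :> rat by [].
case=> p [q [r [s [pqrs Ht]]]]; apply: (path4_type_rank lam01 Ht).
move: pqrs; rewrite !inE.
by do ![case/orP]; move=> /eqP [-> -> -> ->].
Qed.

Lemma type_d_rank (H : sgraph) : type_d H -> (walk_rank H <= 3)%N.
Proof.
case=> p [q [r [[p1 q1 r1] /mixed_blowup [t0 [c Htc]]]]].
apply: (path5_rank t0 Htc); rewrite !(tnth_nth 0) !inordK //=.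
  by split=> //; rewrite quotient_diag_lt0 ?mul0r //; lia.
by split=> //; apply: quotient_diagN1_gt0.
Qed.

Lemma small_rank (H G : sgraph) : (#|G| <= 3)%N -> is_mixed_extension H G ->
  (walk_rank H <= 3)%N.
Proof.
move=> G3 [t /mixed_blowup [t0 [c Htc]]].
exact: leq_trans (blowup_rank t0 Htc) G3.
Qed.

Theorem corollary7p2 (H : sgraph) (H_nonempty : (0 < #|H|)%N)
    (H_connected : graph_connected H) :
  (count (fun x : algC => (x \notin [:: -1; 0])%R) (eigenvalues H) <= 3)%N
  <->
  (exists G : sgraph,
      [/\ (0 < #|G| <= 3)%N, graph_connected G & is_mixed_extension H G])
  \/ (* (a) *)
  (exists p q r : int,
      [/\ 1 <= p, 1 <= q & 1 <= r] /\
      [\/ is_path_mixed_extension H [tuple p; -3; -2; -2],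
          is_path_mixed_extension H [tuple -2; q; r; -2]
        | is_path_mixed_extension H [tuple p; -2; r; -3]])
  \/ (* (b) *)
  (exists p q r s : int,
      [/\ 1 <= r,
          (p, q, s) \in [:: (3, 3, 6); (3, 4, 4); (3, 6, 3); (4, 2, 6);
                            (4, 3, 3); (4, 6, 2); (5, 2, 4); (5, 4, 2);
                            (7, 2, 3); (7, 3, 2)]
        & is_path_mixed_extension H [tuple p; q; - r; s]])
  \/ (* (c) *)
  (exists p q r s : int,
      (p, q, r, s) \in [:: (2, 2, 2, 7); (2, 2, 3, 4); (2, 2, 6, 3);
                           (2, 3, 2, 5); (2, 3, 4, 3); (2, 5, 2, 4);
                           (2, 5, 3, 3); (3, 2, 2, 3)] /\
      is_path_mixed_extension H [tuple p; q; r; s])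
  \/ (* (d) *)
  (exists p q r : int,
      [/\ 1 <= p, 1 <= q & 1 <= r] /\
      is_path_mixed_extension H [tuple 1; p; - q; r; 1]).
Proof.
rewrite count_eigenvalues rank_ratA -/(type_a H) -/(type_b H) -/(type_c H) -/(type_d H).
split=> [/(classification H_nonempty H_connected) | ].
  by case=> [|[]]; tauto.
case=> [[G [/andP [_ G3] _ HG]]|[|[|[]]]].
- exact: small_rank HG.
- exact: type_a_rank.
- exact: type_b_rank.
- exact: type_c_rank.
exact: type_d_rank.
Qed.
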